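(* Let $N\ge3$, $\mu\ge0$, assume (K0) and (F0), and let $p_S(\alpha)<p<p_{JL}(\alpha)$. Let $r^*>0$ and let $u^*$ be a singular solution of $u''+\frac{N-1}{r}u'+K(r)u^p+\mu f(r)=0$, $u>0$, on $(0,r^* )$ (i.e. $\lim_{r\to0}u^*(r)=\infty$). Then for each $\rho\in(0,r^*]$, $$\mathcal{Z}_{(0,\rho)}\big[u(\cdot,\zeta)-u^*\big]\to\infty\quad\text{as }\zeta\to\infty.$$
   Context: (K0): $K:(0,\infty)\to(0,\infty)$ is continuous and $K(r)=(k_0+o(1))r^{\alpha}$ as $r\to0$ for some $\alpha>-2$, $k_0>0$. (F0): $f:(0,\infty)\to[0,\infty)$ is continuous, not identically zero, and $f(r)=O(r^{\nu})$ as $r\to0$ for some $\nu>-2$. $p_S(\alpha):=\frac{N+2+2\alpha}{N-2}$; $p_{JL}(\alpha):=1+\frac{2(2+\alpha)}{N-4-\alpha-\sqrt{(2+\alpha)(2N-2+\alpha)}}$ if $N>10+4\alpha$, and $p_{JL}(\alpha):=\infty$ if $N\le10+4\alpha$. For $\zeta>0$, $u(\cdot,\zeta)$ denotes the regular solution of $u''+\frac{N-1}{r}u'+K(r)\max\{u,0\}^p+\mu f(r)=0$ with $u(0)=\zeta$, i.e. the continuous solution on $[0,\infty)$ of $u(r)=\zeta-\int_0^r\frac{s^{2-N}-r^{2-N}}{N-2}s^{N-1}\big(K(s)\max\{u(s),0\}^p+\mu f(s)\big)ds$. For an interval $I$ and a function $h$ on $I$, $\mathcal{Z}_I[h]$ denotes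 the number of zeros of $h$ in $I$. *)

(* Defs.v *)
From Stdlib Require Import Reals Lra.
From Coquelicot Require Import Coquelicot.
Open Scope R_scope.

(* x^q for real q, with the convention 0^q = 0 (used for q = p > 1). *)
Definition rpow (x q : R) : R := if Rle_dec x 0 then 0 else Rpower x q.

Definition pS (N : nat) (alpha : R) : R := (INR N + 2 + 2 * alpha) / (INR N - 2).

(* "p < p_JL(alpha)", with p_JL(alpha) = +infinity when N <= 10 + 4 alpha. *)
Definition below_pJL (N : nat) (alpha p : R) : Prop :=
  if Rlt_dec (10 + 4 * alpha) (INR N) then
    p < 1 + 2 * (2 + alpha) /
          (INR N - 4 - alpha - sqrt ((2 + alpha) * (2 * INR N - 2 + alpha)))
  else True.

Definition K0 (K : R -> R) (alpha k0 : R) : Prop :=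
  (forall r, 0 < r -> continuous K r) /\
  (forall r, 0 < r -> 0 < K r) /\
  alpha > -2 /\ k0 > 0 /\
  filterlim (fun r => K r / Rpower r alpha) (at_right 0) (locally k0).

Definition F0 (f : R -> R) (nu : R) : Prop :=
  (forall r, 0 < r -> continuous f r) /\
  (forall r, 0 < r -> 0 <= f r) /\
  (exists r, 0 < r /\ f r <> 0) /\
  nu > -2 /\
  (exists C delta, 0 < delta /\ forall r, 0 < r < delta -> f r <= C * Rpower r nu).

Definition kern_integrand (N : nat) (K f : R -> R) (mu p : R) (u : R -> R) (r s : R) : R :=
  (/ s ^ (N - 2) - / r ^ (N - 2)) / (INR N - 2) * s ^ (N - 1)
  * (K s * rpow (Rmax (u s) 0) p + mu * f s).

(* u is the regular solution with u(0) = zeta: continuous on [0,oo), u(0)=zeta and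
   u(r) = zeta - int_0^r ... ds for all r > 0 (improper Riemann integral at 0;
   the integrand is continuous on (0,r] and nonnegative). *)
Definition regular_solution (N : nat) (K f : R -> R) (mu p zeta : R) (u : R -> R) : Prop :=
  u 0 = zeta /\
  filterlim u (at_right 0) (locally zeta) /\
  (forall r, 0 < r -> continuous u r) /\
  (forall r, 0 < r ->
     filterlim (fun e => RInt (kern_integrand N K f mu p u r) e r)
               (at_right 0) (locally (zeta - u r))).

Definition singular_solution (N : nat) (K f : R -> R) (mu p rs : R) (us : R -> R) : Prop :=
  (forall r, 0 < r < rs ->
     ex_derive us r /\ ex_derive (Derive us) r /\ 0 < us r /\
     Derive_n us 2 r + (INR N - 1) / r * Derive us r + K r * Rpower (us r) p + mu * f r = 0) /\
  filterlim us (at_right 0) (Rbar_locally p_infty).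

Definition at_least_zeros (h : R -> R) (a b : R) (M : nat) : Prop :=
  exists t : nat -> R,
    (forall i, (i < M)%nat -> a < t i < b /\ h (t i) = 0) /\
    (forall i, (S i < M)%nat -> t i < t (S i)).

(* Main.v *)
Require Import Defs.
From Stdlib Require Import Reals Lra Lia Classical ClassicalEpsilon Ranalysis5.
From Coquelicot Require Import Coquelicot.
Open Scope R_scope.

(** In the Emden-Fowler variables [t = ln r], [y = exp (theta t) u / A] with
    [theta = (2 + alpha) / (p - 1)], the equation becomes
    [y'' + a y' + L (y^p - y) + e = 0] where [e] tends to [0] as [t -> -oo].
    Since [p > p_S] the friction [a] is positive, and since [p < p_JL] the equilibrium [y = 1] is a
    focus.  A strict Lyapunov function attracts to [y = 1] every orbit that reaches negative
    energy.  The singular solution reaches negative energy at arbitrarily negative times: its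
    energy is asymptotically nonpositive, and if [y] became small then [u] would be bounded.  The
    regular solution has negative energy already at [t = - ln zeta / theta + O(1)], in its initial
    layer.  Hence for large [zeta] both solutions are close to [y = 1] on a common long interval of
    [t], where Sturm comparison makes their difference vanish once in each interval of length
    [PI / omega]. *)

(** * Calculus *)

(** [K] and [f] are only continuous, so the departure from the autonomous system cannot be absorbed
    into a differentiable time-dependent energy. It is treated as an error [e] that enters the
    dissipation estimate only through [e ^ 2] and that is small only while [y] stays bounded; its
    use is therefore tied to a ceiling [y <= M]. Regular orbits start ever earlier as [zeta] grows,
    so trapping must provide an admissible error and a waiting time that depend on the energy level
    and the target alone, not on the orbit or its starting time. The common window then has a fixed
    right end, and a large [zeta] only pushes the start of the regular orbit to the left of it. The
    condition [p < p_JL] enters as [a ^ 2 / 4 < (p - 1) L], the complex-root condition of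
    [v'' + a v' + (p - 1) L v = 0], the linearization at [y = 1]. Its strictness leaves room for [y]
    and [k / k0] to be merely bounded below by some [x0 < 1]. The inhomogeneous term cancels in the
    difference of two solutions, so Sturm comparison meets no error term. *)

Lemma decreasing_of_derive (f df : R -> R) (x y : R) :
  x <= y -> (forall t, x <= t <= y -> is_derive f t (df t)) ->
  (forall t, x <= t <= y -> df t <= 0) -> f y <= f x.
Proof.
  intros Hxy Hd Hle.
  destruct (MVT_gen f x y df) as [c [Hc Heq]].
  - intros t Ht; rewrite Rmin_left, Rmax_right in Ht by lra; apply Hd; lra.
  - intros t Ht; rewrite Rmin_left, Rmax_right in Ht by lra.
    apply continuity_pt_filterlim, (ex_derive_continuous f); exists (df t); apply Hd; lra.
  - rewrite Rmin_left, Rmax_right in Hc by lra.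
    specialize (Hle c Hc); nra.
Qed.

Lemma increasing_of_derive (f df : R -> R) (x y : R) :
  x <= y -> (forall t, x <= t <= y -> is_derive f t (df t)) ->
  (forall t, x <= t <= y -> 0 <= df t) -> f x <= f y.
Proof.
  intros Hxy Hd Hle.
  apply Ropp_le_cancel.
  apply (decreasing_of_derive (fun t => - f t) (fun t => - df t)); trivial.
  - intros t Ht; apply (is_derive_opp f), Hd, Ht.
  - intros t Ht; specialize (Hle t Ht); lra.
Qed.

Ltac use_derive H :=
  match type of H with
  | is_derive ?f ?x ?l =>
      replace (Derive (fun s => f s) x) with l
        by (symmetry; apply is_derive_unique; exact H)
  end.

Lemma exp_le_mono (x y : R) : x <= y -> exp x <= exp y.
Proof. intros [H| ->]; [left; apply exp_increasing, H|apply Rle_refl]. Qed.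

(** Gronwall: [exp (k t) (f t - b)] is nonincreasing. *)
Lemma exp_decay (f df : R -> R) (k b x y : R) :
  x <= y -> (forall t, x <= t <= y -> is_derive f t (df t)) ->
  (forall t, x <= t <= y -> df t <= - k * (f t - b)) ->
  f y - b <= exp (- k * (y - x)) * (f x - b).
Proof.
  intros Hxy Hd Hle.
  assert (H : exp (k * y) * (f y - b) <= exp (k * x) * (f x - b)).
  { apply (decreasing_of_derive (fun t => exp (k * t) * (f t - b))
             (fun t => exp (k * t) * (df t + k * (f t - b)))); trivial.
    - intros t Ht. specialize (Hd t Ht).
      auto_derive; [exists (df t); exact Hd|].
      use_derive Hd; ring.
    - intros t Ht. specialize (Hle t Ht). pose proof (exp_pos (k * t)). nra. }
  replace (- k * (y - x)) with (k * x + - (k * y)) by ring.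
  rewrite exp_plus, exp_Ropp.
  pose proof (exp_pos (k * y)) as Hp.
  apply Rmult_le_reg_l with (exp (k * y)); trivial.
  field_simplify; lra.
Qed.

Lemma continuous_eps (f : R -> R) (t e : R) : continuous f t -> 0 < e ->
  exists d, 0 < d /\ forall s, Rabs (s - t) < d -> Rabs (f s - f t) < e.
Proof.
  intros Hc He.
  destruct (Hc (ball (f t) (mkposreal e He)) (locally_ball _ _)) as [d Hd].
  exists d; split; [apply cond_pos|intros s Hs; apply Hd, Hs].
Qed.

(** A bootstrap: the dissipation estimates need bounds on [y] that only the resulting decay can
    confirm. With [tau] the supremum of the times up to which the weak bounds hold, continuity
    closes them at [tau], [Hstep] makes them strict, and continuity pushes past [tau] unless
    [tau = T]. *)
Lemma continuation (y : R -> R) (lo hi t0 T : R) :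
  (forall t, t0 <= t <= T -> continuous y t) ->
  lo < y t0 < hi ->
  (forall t1, t0 <= t1 <= T -> (forall s, t0 <= s <= t1 -> lo <= y s <= hi) ->
    lo < y t1 < hi) ->
  forall t, t0 <= t <= T -> lo < y t < hi.
Proof.
  intros Hc H0 Hstep.
  destruct (Rle_dec t0 T) as [HT|HT]; [|intros t Ht; lra].
  set (E := fun t => t0 <= t <= T /\ forall s, t0 <= s <= t -> lo <= y s <= hi).
  assert (HE0 : E t0).
  { split; [lra|]. intros s Hs. replace s with t0 by lra. lra. }
  destruct (completeness E) as [tau [Hub Hlub]].
  { exists T. intros t [Ht _]; lra. }
  { now exists t0. }
  assert (Htau : t0 <= tau <= T).
  { split; [now apply Hub|]. apply Hlub. intros t [Ht _]; lra. }
  assert (Hbelow : forall s, t0 <= s < tau -> lo <= y s <= hi).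
  { intros s Hs. apply NNPP; intros Hn.
    assert (tau <= s); [|lra].
    apply Hlub. intros t [Ht HEt]. destruct (Rle_dec t s) as [|Hts]; trivial.
    exfalso; apply Hn, HEt; lra. }
  assert (Hcl : forall s, t0 <= s <= tau -> lo <= y s <= hi).
  { intros s Hs. destruct (Rle_lt_or_eq_dec s tau) as [Hlt|Heq]; [lra|now apply Hbelow|].
    subst s. destruct (Req_dec tau t0) as [->|Hne]; [lra|].
    split; apply Rnot_lt_le; intros Hn.
    - destruct (continuous_eps y tau (lo - y tau) (Hc _ Htau)) as [d [Hd Hy]]; [lra|].
      (* The maximum with [t0] keeps the test point inside the interval, still to the left of
         [tau]. *)
      pose proof (Rmax_l t0 (tau - d/2)). pose proof (Rmax_r t0 (tau - d/2)).
      assert (Rmax t0 (tau - d/2) < tau) by (apply Rmax_lub_lt; lra).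
      specialize (Hy (Rmax t0 (tau - d/2))).
      specialize (Hbelow (Rmax t0 (tau - d/2)) ltac:(lra)).
      rewrite (Rabs_left (_ - tau)) in Hy by lra.
      specialize (Hy ltac:(lra)). apply Rabs_def2 in Hy. lra.
    - destruct (continuous_eps y tau (y tau - hi) (Hc _ Htau)) as [d [Hd Hy]]; [lra|].
      pose proof (Rmax_l t0 (tau - d/2)). pose proof (Rmax_r t0 (tau - d/2)).
      assert (Rmax t0 (tau - d/2) < tau) by (apply Rmax_lub_lt; lra).
      specialize (Hy (Rmax t0 (tau - d/2))).
      specialize (Hbelow (Rmax t0 (tau - d/2)) ltac:(lra)).
      rewrite (Rabs_left (_ - tau)) in Hy by lra.
      specialize (Hy ltac:(lra)). apply Rabs_def2 in Hy. lra. }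
  assert (HtauT : tau = T).
  { apply Rle_antisym; [lra|]. apply Rnot_lt_le; intros Hlt.
    specialize (Hstep tau Htau Hcl).
    set (e := Rmin (y tau - lo) (hi - y tau)).
    assert (He : 0 < e) by (apply Rmin_glb_lt; lra).
    pose proof (Rmin_l (y tau - lo) (hi - y tau)).
    pose proof (Rmin_r (y tau - lo) (hi - y tau)). fold e in H, H1.
    destruct (continuous_eps y tau e (Hc _ Htau) He) as [d [Hd Hy]].
    assert (HE : E (Rmin T (tau + d/2))).
    { pose proof (Rmin_l T (tau + d/2)). pose proof (Rmin_r T (tau + d/2)).
      split; [split; [apply Rmin_glb; lra|lra]|].
      intros s Hs. destruct (Rle_dec s tau) as [Hle|Hgt]; [apply Hcl; lra|].
      specialize (Hy s). rewrite Rabs_right in Hy by lra.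
      specialize (Hy ltac:(lra)). apply Rabs_def2 in Hy. lra. }
    apply Hub in HE.
    assert (tau < Rmin T (tau + d/2)) by (apply Rmin_glb_lt; lra). lra. }
  subst tau. intros t Ht. apply Hstep; trivial. intros s Hs; apply Hcl; lra.
Qed.

Lemma minimum_at (h dh : R -> R) (M x0 y : R) :
  (forall x, 0 < x <= M -> is_derive h x (dh x)) ->
  (forall x, 0 < x <= x0 -> dh x <= 0) ->
  (forall x, x0 <= x <= M -> 0 <= dh x) ->
  0 < x0 <= M -> 0 < y <= M -> h x0 <= h y.
Proof.
  intros Hd Hn Hp Hx0 Hy. destruct (Rle_dec x0 y).
  - apply (increasing_of_derive h dh); trivial; intros t Ht; [apply Hd|apply Hp]; lra.
  - apply (decreasing_of_derive h dh); [lra| |]; intros t Ht; [apply Hd|apply Hn]; lra.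
Qed.

(** * The Lyapunov function of the planar system *)

Section Planar.

Variables (L p a : R).
Hypotheses (L_pos : 0 < L) (p_gt1 : 1 < p) (a_pos : 0 < a).

(** Powers [y ^ p] are written [y * Q y] throughout, which leaves a single transcendental atom to
    the algebra. As an exponential, [Q y] is positive for every real [y]. *)
Definition Q (y : R) : R := Rpower y (p - 1).
Definition force (y : R) : R := L * y * (Q y - 1).
(** The primitive of [force] that vanishes at the equilibrium [0]; with this normalization a
    negative energy keeps [y] away from [0]. *)
Definition potential (y : R) : R := L * y ^ 2 * (Q y / (p + 1) - 1 / 2).

Lemma Q_pos (y : R) : 0 < Q y.
Proof. apply exp_pos. Qed.

Lemma Q_1 : Q 1 = 1.
Proof. unfold Q, Rpower; rewrite ln_1, Rmult_0_r; apply exp_0. Qed.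

Lemma Q_le (x y : R) : 0 < x <= y -> Q x <= Q y.
Proof. intros H; apply Rle_Rpower_l; lra. Qed.

Lemma is_derive_Q (y : R) : 0 < y -> is_derive Q y ((p - 1) * Q y / y).
Proof.
  intros Hy; unfold Q, Rpower. auto_derive; trivial. field; lra.
Qed.

Lemma is_derive_force (y : R) : 0 < y -> is_derive force y (L * (p * Q y - 1)).
Proof.
  intros Hy; unfold force. pose proof (is_derive_Q y Hy) as HQ.
  auto_derive; [eexists; exact HQ|]. use_derive HQ. field; lra.
Qed.

Lemma is_derive_potential (y : R) : 0 < y -> is_derive potential y (force y).
Proof.
  intros Hy; unfold potential. pose proof (is_derive_Q y Hy) as HQ.
  auto_derive; [eexists; exact HQ|]. use_derive HQ. unfold force. field; lra.
Qed.

Lemma force_1 : force 1 = 0.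
Proof. unfold force; rewrite Q_1; ring. Qed.

Lemma force_nonneg (y : R) : 1 <= y -> 0 <= force y.
Proof.
  intros Hy; unfold force. pose proof (Q_le 1 y ltac:(lra)). rewrite Q_1 in H. assert (0 < L * y) by nra. nra.
Qed.

Lemma force_nonpos (y : R) : 0 < y <= 1 -> force y <= 0.
Proof.
  intros Hy; unfold force. pose proof (Q_le y 1 ltac:(lra)). rewrite Q_1 in H.
  assert (0 < L * y) by nra. nra.
Qed.

(** [M] is a ceiling for the orbits, and [B] dominates the slope of [force] below it. *)
Variables (M B : R).
Hypotheses (M_gt1 : 1 < M) (B_bound : L * (p * Q M) <= B).

Lemma B_pos : 0 < B.
Proof. pose proof (Q_pos M). assert (0 < L * (p * Q M)); [|lra]. repeat apply Rmult_lt_0_compat; lra. Qed.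

Lemma force_slope (y : R) : 0 < y <= M -> L * (p * Q y - 1) <= B.
Proof. intros Hy. pose proof (Q_le y M Hy). assert (L * (p * Q y) <= L * (p * Q M)) by (repeat apply Rmult_le_compat_l; lra). lra. Qed.

(** The function [potential - force ^ 2 / (2 B)] has derivative [force * (1 - force' / B)], which
    has the sign of [force] because [force' <= B]; its minimum is therefore at [1]. *)
Lemma potential_gap (y : R) : 0 < y <= M ->
  (force y) ^ 2 / (2 * B) <= potential y - potential 1.
Proof.
  intros Hy. pose proof B_pos as HB.
  enough (H : potential 1 - force 1 ^ 2 / (2 * B) <= potential y - force y ^ 2 / (2 * B)).
  { rewrite force_1 in H. replace (0 ^ 2 / (2 * B)) with 0 in H by (field; lra). lra. }
  apply (minimum_at (fun y => potential y - force y ^ 2 / (2 * B))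
           (fun y => force y * ((B - L * (p * Q y - 1)) / B)) M); try lra.
  - intros x Hx. pose proof (is_derive_potential x ltac:(lra)) as H1.
    pose proof (is_derive_force x ltac:(lra)) as H2.
    auto_derive; [split; [eexists; exact H1|split; trivial; eexists; exact H2]|].
    use_derive H1. use_derive H2. field; lra.
  - intros x Hx. pose proof (force_slope x ltac:(lra)). pose proof (force_nonpos x Hx).
    assert (0 <= (B - L * (p * Q x - 1)) / B) by (apply Rdiv_le_0_compat; lra). nra.
  - intros x Hx. pose proof (force_slope x ltac:(lra)). pose proof (force_nonneg x ltac:(lra)).
    assert (0 <= (B - L * (p * Q x - 1)) / B) by (apply Rdiv_le_0_compat; lra). nra.
Qed.

Lemma force_secant (y : R) : 0 < y <= M -> 0 <= B * (y - 1) ^ 2 - force y * (y - 1).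
Proof.
  intros Hy.
  assert (Hd : forall x, 0 < x -> is_derive (fun x => B * (x - 1) - force x) x
                  (B - L * (p * Q x - 1))).
  { intros x Hx. pose proof (is_derive_force x Hx) as H2.
    auto_derive; [eexists; exact H2|]. use_derive H2. ring. }
  pose proof force_1.
  destruct (Rle_dec 1 y).
  - assert (B * (1 - 1) - force 1 <= B * (y - 1) - force y); [|nra].
    apply (increasing_of_derive (fun x => B * (x - 1) - force x)
             (fun x => B - L * (p * Q x - 1))); trivial; intros t Ht; [apply Hd; lra|].
    pose proof (force_slope t ltac:(lra)); lra.
  - assert (B * (y - 1) - force y <= B * (1 - 1) - force 1); [|nra].
    apply (increasing_of_derive (fun x => B * (x - 1) - force x)
             (fun x => B - L * (p * Q x - 1))); [lra| |]; intros t Ht; [apply Hd; lra|].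
    pose proof (force_slope t ltac:(lra)); lra.
Qed.

Lemma potential_upper (y : R) : 0 < y <= M ->
  potential y - potential 1 <= B / 2 * (y - 1) ^ 2.
Proof.
  intros Hy.
  enough (H : B / 2 * (1 - 1) ^ 2 - potential 1 <= B / 2 * (y - 1) ^ 2 - potential y) by lra.
  apply (minimum_at (fun y => B / 2 * (y - 1) ^ 2 - potential y)
           (fun y => B * (y - 1) - force y) M); try lra.
  - intros x Hx. pose proof (is_derive_potential x ltac:(lra)) as H1.
    auto_derive; [eexists; exact H1|]. use_derive H1. field.
  - intros x Hx. pose proof (force_secant x ltac:(lra)). pose proof force_1.
    destruct (Req_dec x 1) as [->|]; nra.
  - intros x Hx. pose proof (force_secant x ltac:(lra)). pose proof force_1.
    destruct (Req_dec x 1) as [->|]; nra.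
Qed.

(** On [[lo, M]] the slope [(p - 1) Q x / x] of [Q] is at least [(p - 1) Q lo / M], so [Q y - 1]
    dominates a multiple of [y - 1]. A positive [lo] is essential, as [force] also vanishes at
    [0]. *)
Lemma force_lower (lo y : R) : 0 < lo <= 1 -> lo <= y <= M ->
  (L * lo * ((p - 1) * Q lo / M)) ^ 2 * (y - 1) ^ 2 <= force y ^ 2.
Proof.
  intros Hlo Hy. set (c := (p - 1) * Q lo / M).
  pose proof (Q_pos lo).
  assert (Hc : 0 < c) by (unfold c; apply Rdiv_lt_0_compat; [apply Rmult_lt_0_compat|]; lra).
  assert (Hd : forall x, 0 < x -> is_derive (fun x => Q x - c * x) x ((p - 1) * Q x / x - c)).
  { intros x Hx. pose proof (is_derive_Q x Hx) as H2.
    auto_derive; [eexists; exact H2|]. use_derive H2. field; lra. }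
  assert (Hpos : forall x, lo <= x <= M -> 0 <= (p - 1) * Q x / x - c).
  { intros x Hx. pose proof (Q_le lo x ltac:(lra)). unfold c.
    assert (/ M <= / x) by (apply Rinv_le_contravar; lra).
    assert (0 < / M) by (apply Rinv_0_lt_compat; lra).
    assert ((p - 1) * Q lo <= (p - 1) * Q x) by nra.
    assert (0 < (p - 1) * Q lo) by (apply Rmult_lt_0_compat; lra).
    assert ((p - 1) * Q lo * / M <= (p - 1) * Q x * / x) by (apply Rmult_le_compat; lra).
    unfold Rdiv. lra. }
  assert (Habs : c * Rabs (y - 1) <= Rabs (Q y - 1)).
  { pose proof Q_1. destruct (Rle_dec 1 y).
    - assert (Q 1 - c * 1 <= Q y - c * y).
      { apply (increasing_of_derive _ _ 1 y ltac:(lra)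
                 (fun t Ht => Hd t ltac:(lra)) (fun t Ht => Hpos t ltac:(lra))). }
      rewrite !Rabs_right; nra.
    - assert (Q y - c * y <= Q 1 - c * 1).
      { apply (increasing_of_derive _ _ y 1 ltac:(lra)
                 (fun t Ht => Hd t ltac:(lra)) (fun t Ht => Hpos t ltac:(lra))). }
      rewrite !Rabs_left1; nra. }
  assert (Hsq : c ^ 2 * (y - 1) ^ 2 <= (Q y - 1) ^ 2).
  { rewrite <- (pow2_abs (y - 1)), <- (pow2_abs (Q y - 1)), <- Rpow_mult_distr.
    apply pow_incr; split; trivial. apply Rmult_le_pos; [lra|apply Rabs_pos]. }
  unfold force.
  replace ((L * lo * c) ^ 2 * (y - 1) ^ 2) with ((L * lo) ^ 2 * (c ^ 2 * (y - 1) ^ 2)) by ring.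
  replace ((L * y * (Q y - 1)) ^ 2) with ((L * y) ^ 2 * (Q y - 1) ^ 2) by ring.
  apply Rmult_le_compat; [apply pow2_ge_0| |apply pow_incr; nra|trivial].
  apply Rmult_le_pos; apply pow2_ge_0.
Qed.


(** Each smallness condition on [kap] serves one estimate: the fourth lets friction absorb the terms
    in [z ^ 2] created by the cross term, the fifth keeps [lyapunov - potential 1] coercive, and the
    sixth makes [lyapunov] nonnegative on the line [y = M]. *)
Lemma damping_exists : 0 < potential M -> exists kap, 0 < kap /\ kap <= 1 /\ kap <= a /\
  kap * (B + a ^ 2 / 2) <= a / 2 /\ kap * (4 * B) <= 1 /\ kap * force M ^ 2 <= potential M.
Proof.
  intros HG. pose proof B_pos as HB.
  (* Dividing by [c + 1] instead of [c] covers [c = 0]. *)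
  assert (Hq : forall x c, 0 < x -> 0 <= c -> forall k, k <= x / (c + 1) -> k * c <= x).
  { intros x c Hx Hc k Hk. apply Rle_trans with (x / (c + 1) * c).
    - apply Rmult_le_compat_r; trivial.
    - apply Rmult_le_reg_r with (c + 1); [lra|].
      replace (x / (c + 1) * c * (c + 1)) with (x * c) by (field; lra). nra. }
  set (k1 := a / 2 / ((B + a ^ 2 / 2) + 1)). set (k2 := 1 / (4 * B + 1)).
  set (k3 := potential M / (force M ^ 2 + 1)).
  pose proof (pow2_ge_0 a). pose proof (pow2_ge_0 (force M)).
  exists (Rmin (Rmin 1 a) (Rmin k1 (Rmin k2 k3))).
  pose proof (Rmin_l (Rmin 1 a) (Rmin k1 (Rmin k2 k3))).
  pose proof (Rmin_r (Rmin 1 a) (Rmin k1 (Rmin k2 k3))).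
  pose proof (Rmin_l 1 a). pose proof (Rmin_r 1 a).
  pose proof (Rmin_l k1 (Rmin k2 k3)). pose proof (Rmin_r k1 (Rmin k2 k3)).
  pose proof (Rmin_l k2 k3). pose proof (Rmin_r k2 k3).
  repeat split; try lra.
  - repeat apply Rmin_glb_lt; try lra; apply Rdiv_lt_0_compat; lra.
  - apply Hq; [lra|lra|unfold k1 in *; lra].
  - apply Hq; [lra|lra|unfold k2 in *; lra].
  - apply Hq; [lra|lra|unfold k3 in *; lra].
Qed.

Lemma Q_onto (x : R) : 0 < x -> exists m, 0 < m /\ Q m = x.
Proof.
  intros Hx. exists (Rpower x (/ (p - 1))). split; [apply exp_pos|].
  unfold Q. rewrite Rpower_mult, Rinv_l by lra. now apply Rpower_1.
Qed.

Lemma potential_pos : (p + 1) / 2 < Q M -> 0 < potential M.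
Proof.
  intros H. unfold potential. apply Rmult_lt_0_compat.
  - apply Rmult_lt_0_compat; [lra|apply pow_lt; lra].
  - assert (1 / 2 < Q M / (p + 1)); [|lra].
    apply Rmult_lt_reg_r with (p + 1); [lra|].
    replace (Q M / (p + 1) * (p + 1)) with (Q M) by (field; lra). lra.
Qed.

Variable kap : R.
Hypotheses (kap_pos : 0 < kap) (kap_le1 : kap <= 1) (kap_le_a : kap <= a)
  (kap_damping : kap * (B + a ^ 2 / 2) <= a / 2)
  (kap_slope : kap * (4 * B) <= 1)
  (kap_barrier : kap * force M ^ 2 <= potential M).

(* The energy alone has derivative [- a z ^ 2], which does not control [force y]; the cross term
   makes the decay strict away from the equilibria. *)
Definition lyapunov (y z : R) : R := z ^ 2 / 2 + potential y + kap * (z * force y).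

(** The time derivative of [lyapunov] along [y' = z], [z' = - a z - force y - e], as the chain rule
    produces it. *)
Definition lyapunov_rate (y z e : R) : R :=
  z * (- a * z - force y - e) + force y * z +
  kap * ((- a * z - force y - e) * force y + z * (L * (p * Q y - 1) * z)).

Lemma kap_sq : kap ^ 2 <= kap.
Proof. nra. Qed.

Lemma cross_term_le (z g : R) : kap * (z * g) <= (z ^ 2 + g ^ 2) / 2.
Proof.
  apply Rle_trans with (Rabs (kap * (z * g))); [apply Rle_abs|].
  rewrite Rabs_mult, (Rabs_right kap), Rabs_mult by lra.
  rewrite <- (pow2_abs z), <- (pow2_abs g).
  pose proof (Rabs_pos z). pose proof (Rabs_pos g).
  pose proof (pow2_ge_0 (Rabs z - Rabs g)).
  assert (0 <= Rabs z * Rabs g) by nra. nra.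
Qed.

Lemma is_derive_lyapunov (y z e : R -> R) (t : R) :
  0 < y t -> is_derive y t (z t) ->
  is_derive z t (- a * z t - force (y t) - e t) ->
  is_derive (fun s => lyapunov (y s) (z s)) t (lyapunov_rate (y t) (z t) (e t)).
Proof.
  intros Hy Hdy Hdz. unfold lyapunov, lyapunov_rate.
  pose proof (is_derive_comp _ _ _ _ _ (is_derive_potential (y t) Hy) Hdy) as HG.
  pose proof (is_derive_comp _ _ _ _ _ (is_derive_force (y t) Hy) Hdy) as Hg.
  unfold scal in HG, Hg; simpl in HG, Hg; unfold mult in HG, Hg; simpl in HG, Hg.
  (* Naming the compositions makes them atoms for [auto_derive], whose derivatives are then supplied
     by [HG] and [Hg]. *)
  set (G := fun s => potential (y s)) in *. set (g := fun s => force (y s)) in *.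
  change (is_derive (fun s => z s ^ 2 / 2 + G s + kap * (z s * g s)) t
   (z t * (- a * z t - g t - e t) + g t * z t +
    kap * ((- a * z t - g t - e t) * g t + z t * (L * (p * Q (y t) - 1) * z t)))).
  change (is_derive z t (- a * z t - g t - e t)) in Hdz.
  auto_derive; [repeat split; eexists; eassumption|].
  use_derive HG. use_derive Hg. use_derive Hdz. unfold g. field.
Qed.

(** Completed squares absorb the mixed terms. [H1] trades [e z] for a quarter of the friction, and
    [H2] trades [z g] and [e g] for three quarters of the new term [- kap g ^ 2]. Then [kap_damping]
    leaves [- (a / 4) z ^ 2], and [kap <= a] gives the common rate [kap / 4]. *)
Lemma lyapunov_rate_le (y z e : R) : 0 < y <= M ->
  lyapunov_rate y z e <= - (kap / 4) * (z ^ 2 + force y ^ 2) + (1 / a + kap) * e ^ 2.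
Proof.
  intros Hy. unfold lyapunov_rate. set (g := force y).
  pose proof (force_slope y Hy) as Hs. set (s := L * (p * Q y - 1)) in *.
  assert (H1 : 0 <= / a * (a / 2 * z + e) ^ 2).
  { apply Rmult_le_pos; [left; apply Rinv_0_lt_compat; lra|apply pow2_ge_0]. }
  replace (/ a * (a / 2 * z + e) ^ 2) with (a / 4 * z ^ 2 + e * z + 1 / a * e ^ 2) in H1
    by (field; lra).
  assert (H2 : 0 <= kap * ((g + a * z) ^ 2 / 2 + (g / 2 + e) ^ 2)) by
    (apply Rmult_le_pos; [lra|]; pose proof (pow2_ge_0 (g + a * z));
     pose proof (pow2_ge_0 (g / 2 + e)); lra).
  assert (H3 : kap * s * z ^ 2 <= kap * B * z ^ 2).
  { apply Rmult_le_compat_r; [apply pow2_ge_0|]. apply Rmult_le_compat_l; lra. }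
  assert (H4 : kap * (B + a ^ 2 / 2) * z ^ 2 <= a / 2 * z ^ 2)
    by (apply Rmult_le_compat_r; [apply pow2_ge_0|lra]).
  assert (H5 : kap * z ^ 2 <= a * z ^ 2) by (apply Rmult_le_compat_r; [apply pow2_ge_0|lra]).
  nra.
Qed.

(** With [D = potential y - potential 1], [potential_gap] gives [g ^ 2 <= 2 B D], so the cross term
    costs at most [z ^ 2 / 4 + kap ^ 2 g ^ 2 <= z ^ 2 / 4 + D / 2]. The factor [B + 1] serves both
    remaining terms at once. *)
Lemma lyapunov_ge (y z : R) : 0 < y <= M ->
  (z ^ 2 + force y ^ 2) / (4 * (B + 1)) <= lyapunov y z - potential 1.
Proof.
  intros Hy. unfold lyapunov. pose proof B_pos as HB.
  pose proof (potential_gap y Hy) as Hg. set (g := force y) in *.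
  set (D := potential y - potential 1) in *.
  replace (z ^ 2 / 2 + potential y + kap * (z * g) - potential 1)
    with (z ^ 2 / 2 + D + kap * (z * g)) by (unfold D; ring).
  assert (H1 : kap * (4 * B) * (kap * g ^ 2) <= 1 * (kap * g ^ 2)).
  { apply Rmult_le_compat_r; [pose proof (pow2_ge_0 g); nra|trivial]. }
  assert (H2 : 0 <= (z / 2 + kap * g) ^ 2) by apply pow2_ge_0.
  assert (Hg2 : g ^ 2 <= 2 * B * D).
  { replace (g ^ 2) with (2 * B * (g ^ 2 / (2 * B))) by (field; lra).
    apply Rmult_le_compat_l; lra. }
  assert (HD : 0 <= D).
  { eapply Rle_trans; [|exact Hg]. apply Rdiv_le_0_compat; [apply pow2_ge_0|lra]. }
  assert (Hk : kap ^ 2 * g ^ 2 <= D / 2).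
  { apply Rle_trans with (kap ^ 2 * (2 * B * D)).
    - apply Rmult_le_compat_l; [apply pow2_ge_0|trivial].
    - assert (kap ^ 2 * (2 * B) <= 1 / 2); [|nra].
      pose proof kap_sq. assert (kap ^ 2 * (2 * B) <= kap * (2 * B)) by nra. lra. }
  apply Rmult_le_reg_r with (4 * (B + 1)); [lra|].
  replace ((z ^ 2 + g ^ 2) / (4 * (B + 1)) * (4 * (B + 1))) with (z ^ 2 + g ^ 2) by (field; lra).
  assert (H3 : z ^ 2 / 4 + D / 2 <= z ^ 2 / 2 + D + kap * (z * g)) by nra.
  pose proof (pow2_ge_0 z). nra.
Qed.

(** Converse of [lyapunov_ge] away from [0]: the gap is at most quadratic in [y - 1], hence at most
    a multiple of [force ^ 2]. It turns the dissipation into exponential decay towards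
    [potential 1]. *)
Lemma lyapunov_le_near (lo y z : R) : 0 < lo <= 1 -> lo <= y <= M ->
  lyapunov y z - potential 1 <=
  (1 + B / 2 / (L * lo * ((p - 1) * Q lo / M)) ^ 2) * (z ^ 2 + force y ^ 2).
Proof.
  intros Hlo Hy. unfold lyapunov. pose proof B_pos as HB.
  pose proof (potential_upper y ltac:(lra)) as Hu.
  pose proof (force_lower lo y Hlo Hy) as Hl. set (g := force y) in *.
  set (c := (L * lo * ((p - 1) * Q lo / M))) in *.
  assert (Hc : 0 < c).
  { pose proof (Q_pos lo). unfold c. apply Rmult_lt_0_compat; [nra|].
    apply Rdiv_lt_0_compat; [apply Rmult_lt_0_compat|]; lra. }
  assert (Hc2 : 0 < c ^ 2) by (apply pow_lt; trivial).
  assert (H1 : potential y - potential 1 <= B / 2 / c ^ 2 * g ^ 2).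
  { eapply Rle_trans; [exact Hu|].
    apply Rmult_le_reg_r with (c ^ 2); trivial.
    replace (B / 2 / c ^ 2 * g ^ 2 * c ^ 2) with (B / 2 * g ^ 2) by (field; lra). nra. }
  pose proof (cross_term_le z g) as H2.
  assert (H3 : 0 <= B / 2 / c ^ 2) by (apply Rdiv_le_0_compat; lra).
  pose proof (pow2_ge_0 z). pose proof (pow2_ge_0 g). nra.
Qed.

(** Superquadraticity gives [potential y <= y * force y / 2], so a small force forces a small energy
    from above even near [0], where [force_lower] fails. The price is the slack [eta / 2] from
    Young's inequality. *)
Lemma lyapunov_le_global (eta y z : R) : 0 < eta -> 0 < y <= M ->
  lyapunov y z <= eta / 2 + (1 + M ^ 2 / (8 * eta)) * (z ^ 2 + force y ^ 2).
Proof.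
  intros He Hy. unfold lyapunov.
  assert (HG : potential y <= y * force y / 2).
  { unfold potential, force. pose proof (Q_pos y).
    assert (/ (p + 1) <= / 2) by (apply Rinv_le_contravar; lra).
    assert (Q y / (p + 1) <= Q y / 2) by (unfold Rdiv; nra).
    assert (0 <= L * y ^ 2) by (pose proof (pow2_ge_0 y); nra). nra. }
  set (g := force y) in *.
  pose proof (cross_term_le z g) as H2.
  assert (H3 : y * g / 2 <= eta / 2 + M ^ 2 / (8 * eta) * g ^ 2).
  { apply Rle_trans with (eta / 2 + y ^ 2 / (8 * eta) * g ^ 2).
    - apply Rmult_le_reg_r with (8 * eta); [lra|].
      replace ((eta / 2 + y ^ 2 / (8 * eta) * g ^ 2) * (8 * eta))
        with (4 * eta ^ 2 + (y * g) ^ 2) by (field; lra).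
      pose proof (pow2_ge_0 (2 * eta - y * g)). nra.
    - apply Rplus_le_compat_l, Rmult_le_compat_r; [apply pow2_ge_0|].
      apply Rmult_le_compat_r; [left; apply Rinv_0_lt_compat; lra|].
      apply pow_incr; lra. }
  assert (0 <= M ^ 2 / (8 * eta)) by (apply Rdiv_le_0_compat; [apply pow2_ge_0|lra]).
  pose proof (pow2_ge_0 z). pose proof (pow2_ge_0 g). nra.
Qed.

(** Completing the square in [z] leaves [potential y - kap * force y ^ 2], which is nonnegative at
    [y = M] by [kap_barrier] and at least [- C y ^ 2] near [0]. A negative level thus excludes both
    ends. *)
Lemma lyapunov_trap (eta : R) : 0 < eta -> exists lo, 0 < lo < 1 /\
  forall y z, 0 < y <= M -> lyapunov y z <= - eta -> lo < y < M.
Proof.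
  intros He. set (C := L / 2 + L ^ 2 * (Q M + 1) ^ 2).
  assert (HC : 0 < C) by (unfold C; pose proof (pow2_ge_0 (Q M + 1)); pose proof (pow2_ge_0 L); nra).
  assert (Hlow : forall y z, potential y - kap * force y ^ 2 <= lyapunov y z).
  { intros y z. unfold lyapunov. set (g := force y).
    pose proof (pow2_ge_0 (z + kap * g)). pose proof kap_sq.
    pose proof (pow2_ge_0 g). pose proof (pow2_ge_0 z).
    assert (kap ^ 2 * g ^ 2 <= kap * g ^ 2) by nra. nra. }
  (* The entry [1 / 2] keeps the floor below [1] and also gives [y ^ 2 <= y] for [y] under it. *)
  exists (Rmin (1 / 2) (eta / (2 * C))). split.
  { split; [apply Rmin_glb_lt; [lra|apply Rdiv_lt_0_compat; lra]|].
    eapply Rle_lt_trans; [apply Rmin_l|lra]. }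
  intros y z Hy HV. specialize (Hlow y z). split.
  - apply Rnot_le_lt; intros Hle.
    assert (H1 : y <= 1 / 2) by (eapply Rle_trans; [exact Hle|apply Rmin_l]).
    assert (H2 : y * (2 * C) <= eta).
    { replace eta with (eta / (2 * C) * (2 * C)) by (field; lra).
      apply Rmult_le_compat_r; [lra|]. eapply Rle_trans; [exact Hle|apply Rmin_r]. }
    assert (H3 : y ^ 2 * (2 * C) <= eta) by nra.
    assert (H4 : - C * y ^ 2 <= potential y - kap * force y ^ 2); [|nra].
    pose proof (Q_le y M Hy). pose proof (Q_pos y).
    assert (Hf : force y ^ 2 <= L ^ 2 * (Q M + 1) ^ 2 * y ^ 2).
    { unfold force. replace ((L * y * (Q y - 1)) ^ 2) with ((L ^ 2 * y ^ 2) * (Q y - 1) ^ 2) by ring.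
      replace (L ^ 2 * (Q M + 1) ^ 2 * y ^ 2) with ((L ^ 2 * y ^ 2) * (Q M + 1) ^ 2) by ring.
      apply Rmult_le_compat_l; [pose proof (pow2_ge_0 L); pose proof (pow2_ge_0 y); nra|nra]. }
    assert (Hp : - (L / 2) * y ^ 2 <= potential y).
    { unfold potential. assert (0 < Q y / (p + 1)) by (apply Rdiv_lt_0_compat; lra).
      assert (0 < L * y ^ 2) by (apply Rmult_lt_0_compat; [lra|apply pow_lt; lra]). nra. }
    unfold C. pose proof (pow2_ge_0 (force y)). nra.
  - destruct (Rle_lt_or_eq_dec y M) as [|Heq]; [lra|trivial|]. subst y. lra.
Qed.

Lemma potential_1_neg : potential 1 < 0.
Proof.
  unfold potential; rewrite Q_1.
  assert (/ (p + 1) < / 2) by (apply Rinv_lt_contravar; lra).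
  unfold Rdiv. nra.
Qed.

Lemma near_rate (lo : R) : 0 < lo <= 1 -> exists k, 0 < k /\
  forall y z e, lo <= y <= M ->
  lyapunov_rate y z e <= - k * (lyapunov y z - potential 1) + (1 / a + kap) * e ^ 2.
Proof.
  intros Hlo. set (C := 1 + B / 2 / (L * lo * ((p - 1) * Q lo / M)) ^ 2).
  assert (HC : 0 < C).
  { pose proof B_pos. unfold C. pose proof (Q_pos lo).
    assert (0 < (L * lo * ((p - 1) * Q lo / M)) ^ 2).
    { apply pow_lt, Rmult_lt_0_compat; [nra|].
      apply Rdiv_lt_0_compat; [apply Rmult_lt_0_compat|]; lra. }
    assert (0 < B / 2 / (L * lo * ((p - 1) * Q lo / M)) ^ 2) by (apply Rdiv_lt_0_compat; lra).
    lra. }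
  exists (kap / 4 / C). split; [apply Rdiv_lt_0_compat; lra|].
  intros y z e Hy. pose proof (lyapunov_rate_le y z e ltac:(lra)) as H1.
  pose proof (lyapunov_le_near lo y z Hlo Hy) as H2. fold C in H2.
  enough (kap / 4 / C * (lyapunov y z - potential 1) <= kap / 4 * (z ^ 2 + force y ^ 2)) by lra.
  replace (kap / 4 * (z ^ 2 + force y ^ 2)) with (kap / 4 / C * (C * (z ^ 2 + force y ^ 2)))
    by (field; lra).
  apply Rmult_le_compat_l; trivial. left; apply Rdiv_lt_0_compat; lra.
Qed.

Lemma global_rate (eta : R) : 0 < eta -> exists k, 0 < k /\
  forall y z e, 0 < y <= M ->
  lyapunov_rate y z e <= - k * (lyapunov y z - eta / 2) + (1 / a + kap) * e ^ 2.
Proof.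
  intros He. set (C := 1 + M ^ 2 / (8 * eta)).
  assert (HC : 0 < C).
  { unfold C. assert (0 <= M ^ 2 / (8 * eta)) by (apply Rdiv_le_0_compat; [apply pow2_ge_0|lra]).
    lra. }
  exists (kap / 4 / C). split; [apply Rdiv_lt_0_compat; lra|].
  intros y z e Hy. pose proof (lyapunov_rate_le y z e ltac:(lra)) as H1.
  pose proof (lyapunov_le_global eta y z He Hy) as H2. fold C in H2.
  enough (kap / 4 / C * (lyapunov y z - eta / 2) <= kap / 4 * (z ^ 2 + force y ^ 2)) by lra.
  replace (kap / 4 * (z ^ 2 + force y ^ 2)) with (kap / 4 / C * (C * (z ^ 2 + force y ^ 2)))
    by (field; lra).
  apply Rmult_le_compat_l; [left; apply Rdiv_lt_0_compat|]; lra.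
Qed.

Lemma small_error (k x : R) : 0 < k -> 0 < x -> exists eps, 0 < eps /\
  forall e, Rabs e <= eps -> (1 / a + kap) * e ^ 2 <= k * x.
Proof.
  intros Hk Hx. set (C := 1 / a + kap).
  assert (HC : 0 < C) by (unfold C; assert (0 < 1 / a) by (apply Rdiv_lt_0_compat; lra); lra).
  assert (Hkx : 0 < k * x / C) by (apply Rdiv_lt_0_compat; nra).
  exists (Rmin 1 (k * x / C)). split; [apply Rmin_glb_lt; lra|].
  intros e He. rewrite <- pow2_abs. pose proof (Rabs_pos e).
  pose proof (Rmin_l 1 (k * x / C)). pose proof (Rmin_r 1 (k * x / C)).
  replace (k * x) with (C * (k * x / C)) by (field; lra).
  apply Rmult_le_compat_l; nra.
Qed.

(** * Trapping of orbits with negative energy *)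

(** Quantitative substitute for the limit of [exp (- w)]; it makes waiting times explicit. *)
Lemma exp_neg_le (w : R) : 0 <= w -> exp (- w) * (1 + w) <= 1.
Proof.
  intros Hw. pose proof (exp_ineq1_le w). pose proof (exp_pos (- w)).
  assert (exp (- w) * exp w = 1) by (rewrite <- exp_plus, <- exp_0; f_equal; ring). nra.
Qed.

(** While [y] stays in [[lo, M]], [lyapunov] decays towards [potential 1] up to the error; this
    keeps its level below [- eta / 2], which confirms the bounds through [continuation]. Both [eps]
    and [S] are fixed before the orbit and its starting time. *)
Lemma trap (eta x0 : R) : 0 < eta -> 0 < x0 < 1 -> exists eps S, 0 < eps /\ 0 <= S /\
  forall (y z e : R -> R) (t0 T : R),
  (forall t, t0 <= t <= T -> is_derive y t (z t)) ->
  (forall t, t0 <= t <= T -> 0 < y t -> is_derive z t (- a * z t - force (y t) - e t)) ->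
  (forall t, t0 <= t <= T -> 0 < y t <= M -> Rabs (e t) <= eps) ->
  0 < y t0 <= M -> lyapunov (y t0) (z t0) <= - eta ->
  forall t, t0 + S <= t <= T -> x0 <= y t.
Proof.
  intros Heta Hx0.
  destruct (lyapunov_trap (eta / 2) ltac:(lra)) as [lo [Hlo Htrap]].
  destruct (near_rate lo ltac:(lra)) as [k [Hk Hrate]].
  pose proof B_pos as HB. pose proof potential_1_neg as HG1.
  set (c2 := (L * lo * ((p - 1) * Q lo / M)) ^ 2).
  assert (Hc2 : 0 < c2).
  { pose proof (Q_pos lo). apply pow_lt, Rmult_lt_0_compat; [nra|].
    apply Rdiv_lt_0_compat; [apply Rmult_lt_0_compat|]; lra. }
  (* A value [y < x0] costs [lyapunov] more than [m] above [potential 1], by [force_lower] and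
     [lyapunov_ge]. *)
  set (m := c2 * (1 - x0) ^ 2 / (4 * (B + 1))).
  assert (Hm : 0 < m).
  { unfold m. apply Rdiv_lt_0_compat; [apply Rmult_lt_0_compat; [|apply pow_lt]; lra|lra]. }
  (* The error may hold the orbit up to [b] above [potential 1]. Since [potential 1 <= - eta], the
     bound [eta / 2] keeps that level below [- eta / 2]; the bound [m / 2] reserves half of [m] for
     the transient. *)
  set (b := Rmin (eta / 2) (m / 2)).
  assert (Hb : 0 < b) by (apply Rmin_glb_lt; lra).
  assert (Hb1 : b <= eta / 2) by apply Rmin_l.
  assert (Hb2 : b <= m / 2) by apply Rmin_r.
  destruct (small_error k b Hk Hb) as [eps [Heps Herr]].
  (* By [exp_neg_le], after this time the transient, initially at most [- potential 1], is at most
     [m / 2]. *)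
  set (S := 2 * (- potential 1) / m / k).
  assert (HS : 0 < S) by (unfold S; apply Rdiv_lt_0_compat; [apply Rdiv_lt_0_compat|]; lra).
  exists eps, S. split; [trivial|split; [lra|]].
  intros y z e t0 T Hdy Hdz He Hy0 HV0.
  assert (Hder : forall t, t0 <= t <= T -> 0 < y t ->
    is_derive (fun s => lyapunov (y s) (z s)) t (lyapunov_rate (y t) (z t) (e t))).
  { intros t Ht Hyt. apply is_derive_lyapunov; auto. }
  assert (Hdecay : forall t1, t0 <= t1 <= T -> (forall s, t0 <= s <= t1 -> lo <= y s <= M) ->
    lyapunov (y t1) (z t1) - (potential 1 + b) <=
    exp (- k * (t1 - t0)) * (lyapunov (y t0) (z t0) - (potential 1 + b))).
  { intros t1 Ht1 Hs.
    apply (exp_decay (fun s => lyapunov (y s) (z s))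
             (fun s => lyapunov_rate (y s) (z s) (e s))); [lra| |].
    - intros t Ht. specialize (Hs t ltac:(lra)). apply Hder; lra.
    - intros t Ht. specialize (Hs t ltac:(lra)).
      specialize (Hrate (y t) (z t) (e t) Hs).
      specialize (Herr (e t) (He t ltac:(lra) ltac:(lra))). lra. }
  assert (HV0' : potential 1 <= lyapunov (y t0) (z t0)).
  { pose proof (lyapunov_ge (y t0) (z t0) Hy0).
    assert (0 <= (z t0 ^ 2 + force (y t0) ^ 2) / (4 * (B + 1))); [|lra].
    apply Rdiv_le_0_compat; [|lra].
    pose proof (pow2_ge_0 (z t0)); pose proof (pow2_ge_0 (force (y t0))); lra. }
  assert (Hin : forall t, t0 <= t <= T -> lo < y t < M).
  { apply continuation.
    - intros t Ht. apply (ex_derive_continuous y). exists (z t); apply Hdy, Ht.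
    - apply Htrap with (z t0); lra.
    - intros t1 Ht1 Hs. apply Htrap with (z t1).
      { specialize (Hs t1 ltac:(lra)); lra. }
      specialize (Hdecay t1 Ht1 Hs).
      assert (Hx : exp (- k * (t1 - t0)) <= 1).
      { rewrite <- exp_0. apply exp_le_mono. nra. }
      pose proof (exp_pos (- k * (t1 - t0))).
      destruct (Rle_dec 0 (lyapunov (y t0) (z t0) - (potential 1 + b))); nra. }
  intros t Ht. apply Rnot_lt_le; intros Hlt.
  pose proof (Hin t ltac:(lra)) as Hyt.
  specialize (Hdecay t ltac:(lra)).
  assert (Hs : forall s, t0 <= s <= t -> lo <= y s <= M).
  { intros s Hs; specialize (Hin s ltac:(lra)); lra. }
  specialize (Hdecay Hs).
  pose proof (lyapunov_ge (y t) (z t) ltac:(lra)) as H1.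
  pose proof (force_lower lo (y t) ltac:(lra) ltac:(lra)) as H2. fold c2 in H2.
  assert (H3 : m < (z t ^ 2 + force (y t) ^ 2) / (4 * (B + 1))).
  { unfold m. apply Rmult_lt_compat_r; [apply Rinv_0_lt_compat; lra|].
    pose proof (pow2_ge_0 (z t)).
    assert (c2 * (1 - x0) ^ 2 < c2 * (y t - 1) ^ 2) by (apply Rmult_lt_compat_l; nra). lra. }
  assert (H4 : exp (- k * (t - t0)) * (- potential 1) <= m / 2).
  { pose proof (exp_neg_le (k * (t - t0)) ltac:(nra)) as Hn.
    replace (- (k * (t - t0))) with (- k * (t - t0)) in Hn by ring.
    pose proof (exp_pos (- k * (t - t0))).
    assert (k * S = 2 * (- potential 1) / m) by (unfold S; field; lra).
    assert (2 * - potential 1 / m <= 1 + k * (t - t0)) by nra.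
    assert (exp (- k * (t - t0)) * (2 * - potential 1 / m) <= 1) by nra.
    apply Rmult_le_reg_r with (2 / m); [apply Rdiv_lt_0_compat; lra|].
    replace (m / 2 * (2 / m)) with 1 by (field; lra).
    replace (exp (- k * (t - t0)) * - potential 1 * (2 / m))
      with (exp (- k * (t - t0)) * (2 * - potential 1 / m)) by (field; lra). lra. }
  pose proof (exp_pos (- k * (t - t0))). nra.
Qed.

(** * Orbits bounded for all negative times *)

(** Once the error is small, an excess of [lyapunov] over [eta] grows exponentially backward in
    time, which the boundedness of the orbit forbids. *)
Lemma backward_energy_upper (y z e : R -> R) (T0 Zb : R) :
  (forall t, t <= T0 -> is_derive y t (z t)) ->
  (forall t, t <= T0 -> is_derive z t (- a * z t - force (y t) - e t)) ->
  (forall eps, 0 < eps -> exists T, forall t, t <= T -> Rabs (e t) <= eps) ->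
  (forall t, t <= T0 -> 0 < y t <= M) ->
  (forall t, t <= T0 -> Rabs (z t) <= Zb) ->
  forall eta, 0 < eta -> exists T, T <= T0 /\ forall t, t <= T -> lyapunov (y t) (z t) <= eta.
Proof.
  intros Hdy Hdz He Hy Hz eta Heta.
  assert (HVb : exists Vb, 0 < Vb /\ forall t, t <= T0 -> lyapunov (y t) (z t) <= Vb).
  { exists (1 / 2 + (1 + M ^ 2 / (8 * 1)) * (Zb ^ 2 + (L * M * (Q M + 1)) ^ 2)).
    assert (Hc : 0 <= M ^ 2 / (8 * 1)) by (pose proof (pow2_ge_0 M); lra).
    split.
    { pose proof (pow2_ge_0 Zb). pose proof (pow2_ge_0 (L * M * (Q M + 1))). nra. }
    intros t Ht. eapply Rle_trans; [apply (lyapunov_le_global 1); [lra|auto]|].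
    apply Rplus_le_compat_l, Rmult_le_compat_l; [lra|].
    apply Rplus_le_compat.
    - rewrite <- pow2_abs. apply pow_incr; split; [apply Rabs_pos|auto].
    - unfold force. rewrite <- pow2_abs. apply pow_incr; split; [apply Rabs_pos|].
      specialize (Hy t Ht). pose proof (Q_pos (y t)). pose proof (Q_le (y t) M Hy).
      rewrite Rabs_mult, (Rabs_right (L * y t)) by nra.
      apply Rmult_le_compat; [nra|apply Rabs_pos|nra|apply Rabs_le; lra]. }
  destruct HVb as [Vb [HVb0 HVb]].
  destruct (global_rate eta Heta) as [k [Hk Hrate]].
  destruct (small_error k (eta / 2) Hk ltac:(lra)) as [eps [Heps Herr]].
  destruct (He eps Heps) as [T HT].
  exists (Rmin T T0). split; [apply Rmin_r|].
  intros t Ht. pose proof (Rmin_l T T0). pose proof (Rmin_r T T0).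
  apply Rnot_lt_le; intros Hlt. set (x := lyapunov (y t) (z t) - eta).
  assert (Hx : 0 < x) by (unfold x; lra).
  (* Going back by [w / k] gives [x <= exp (- w) * Vb = exp (- w) * w * x < x]. *)
  set (w := Vb / x). assert (Hw : 0 < w) by (apply Rdiv_lt_0_compat; lra).
  assert (Hd : x <= exp (- k * (t - (t - w / k))) * (lyapunov (y (t - w / k)) (z (t - w / k)) - eta)).
  { assert (0 < w / k) by (apply Rdiv_lt_0_compat; lra).
    apply (exp_decay (fun s => lyapunov (y s) (z s))
             (fun s => lyapunov_rate (y s) (z s) (e s))); [lra| |].
    - intros s Hs. apply is_derive_lyapunov; [apply Hy|apply Hdy|apply Hdz]; lra.
    - intros s Hs. specialize (Hrate (y s) (z s) (e s) (Hy s ltac:(lra))).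
      specialize (Herr (e s) (HT s ltac:(lra))). lra. }
  replace (- k * (t - (t - w / k))) with (- w) in Hd by (field; lra).
  pose proof (exp_neg_le w ltac:(lra)) as Hn. pose proof (exp_pos (- w)).
  assert (0 < w / k) by (apply Rdiv_lt_0_compat; lra).
  specialize (HVb (t - w / k) ltac:(lra)).
  assert (H3 : x <= exp (- w) * Vb) by nra.
  assert (H4 : w * x = Vb) by (unfold w; field; lra).
  rewrite <- H4 in H3. nra.
Qed.

(** When [y >= y1] at some time, the slope bound keeps [y >= y1 / 2] for a duration [tau]
    independent of that time. There the energy decays at a uniform rate towards [potential 1 < 0];
    starting almost nonpositive, it ends definitely negative. *)
Lemma backward_energy_negative (y z e : R -> R) (T0 Zb y1 : R) :
  (forall t, t <= T0 -> is_derive y t (z t)) ->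
  (forall t, t <= T0 -> is_derive z t (- a * z t - force (y t) - e t)) ->
  (forall eps, 0 < eps -> exists T, forall t, t <= T -> Rabs (e t) <= eps) ->
  (forall t, t <= T0 -> 0 < y t <= M) ->
  (forall t, t <= T0 -> Rabs (z t) <= Zb) ->
  0 < y1 -> (forall T, exists t, t <= T /\ y1 <= y t) ->
  exists eta, 0 < eta /\ forall T, exists t, t <= T /\ lyapunov (y t) (z t) <= - eta.
Proof.
  intros Hdy Hdz He Hy Hz Hy1 Hlarge.
  assert (HZb : 0 <= Zb) by (specialize (Hz T0 ltac:(lra)); pose proof (Rabs_pos (z T0)); lra).
  set (lo := Rmin (y1 / 2) (1 / 2)).
  assert (Hlo : 0 < lo) by (apply Rmin_glb_lt; lra).
  assert (Hlo1 : lo <= y1 / 2) by apply Rmin_l.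
  assert (Hlo2 : lo <= 1 / 2) by apply Rmin_r.
  set (tau := y1 / (2 * (Zb + 1))).
  assert (Htau : 0 < tau) by (apply Rdiv_lt_0_compat; lra).
  destruct (near_rate lo ltac:(lra)) as [k [Hk Hrate]].
  pose proof potential_1_neg as HG1.
  set (r := exp (- k * tau)).
  assert (Hr : 0 < r < 1).
  { split; [apply exp_pos|]. unfold r. rewrite <- exp_0. apply exp_increasing. nra. }
  (* Decay by the factor [r] from level [eta] ends at most at
     [potential 1 * (1 - r) + eta = - 3 eta]. *)
  set (eta := - potential 1 * (1 - r) / 4).
  assert (Heta : 0 < eta) by (unfold eta; nra).
  exists eta; split; trivial. intros T.
  destruct (backward_energy_upper y z e T0 Zb Hdy Hdz He Hy Hz eta Heta) as [T1 [HT1 HV]].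
  destruct (small_error k eta Hk Heta) as [eps [Heps Herr]].
  destruct (He eps Heps) as [T2 HT2].
  destruct (Hlarge (Rmin T (Rmin T1 T2) - tau)) as [t [Ht Hyt]].
  assert (t + tau <= T /\ t + tau <= T1 /\ t + tau <= T2) as [Ht1 [Ht2 Ht3]].
  { pose proof (Rmin_l T (Rmin T1 T2)). pose proof (Rmin_r T (Rmin T1 T2)).
    pose proof (Rmin_l T1 T2). pose proof (Rmin_r T1 T2). lra. }
  exists (t + tau); split; trivial.
  assert (Hys : forall s, t <= s <= t + tau -> lo <= y s).
  { intros s Hs.
    assert (y t + Zb * t <= y s + Zb * s).
    { apply (increasing_of_derive (fun s => y s + Zb * s) (fun s => z s + Zb)); [lra| |].
      - intros v Hv. pose proof (Hdy v ltac:(lra)) as H1.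
        auto_derive; [eexists; exact H1|]. use_derive H1. ring.
      - intros v Hv. specialize (Hz v ltac:(lra)). apply Rabs_le_between in Hz. lra. }
    assert (Zb * (s - t) <= Zb * tau) by (apply Rmult_le_compat_l; lra).
    assert ((Zb + 1) * tau = y1 / 2) by (unfold tau; field; lra). nra. }
  assert (Hd : lyapunov (y (t + tau)) (z (t + tau)) - (potential 1 + eta) <=
    exp (- k * (t + tau - t)) * (lyapunov (y t) (z t) - (potential 1 + eta))).
  { apply (exp_decay (fun s => lyapunov (y s) (z s))
             (fun s => lyapunov_rate (y s) (z s) (e s))); [lra| |].
    - intros s Hs. apply is_derive_lyapunov; [apply Hy|apply Hdy|apply Hdz]; lra.
    - intros s Hs. specialize (Hys s ltac:(lra)). pose proof (Hy s ltac:(lra)).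
      specialize (Hrate (y s) (z s) (e s) ltac:(lra)).
      specialize (Herr (e s) (HT2 s ltac:(lra))). lra. }
  replace (t + tau - t) with tau in Hd by ring. fold r in Hd.
  specialize (HV t ltac:(lra)). unfold eta in *. nra.
Qed.

End Planar.

(** * Sturm comparison near the equilibrium *)

(** The Wronskian [W] is nonincreasing as [sin >= 0] on the half period, yet the values [0] of the
    sine and [1], [-1] of the cosine make [W] negative at the left end and positive at the right
    one. *)
Lemma sturm_zero_free (a omega s : R) (z v w : R -> R) : 0 < omega ->
  (forall t, s <= t <= s + PI / omega -> is_derive z t (v t)) ->
  (forall t, s <= t <= s + PI / omega -> is_derive v t (w t)) ->
  (forall t, s <= t <= s + PI / omega -> w t <= - a * v t - (omega ^ 2 + a ^ 2 / 4) * z t) ->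
  (forall t, s <= t <= s + PI / omega -> 0 < z t) -> False.
Proof.
  intros Hom Hz Hv Hw Hpos.
  assert (Hpi : 0 < PI / omega) by (apply Rdiv_lt_0_compat; [apply PI_RGT_0|trivial]).
  set (e := s + PI / omega) in *.
  set (E := fun t => exp (a / 2 * (t - s))).
  (* Wronskian of [exp (a t / 2) z] and [sin (omega (t - s))]. *)
  set (W := fun t => E t * ((v t + a / 2 * z t) * sin (omega * (t - s))
                            - z t * (omega * cos (omega * (t - s))))).
  assert (H : W e <= W s).
  { apply (decreasing_of_derive W (fun t => E t * (sin (omega * (t - s)) *
       (w t + a * v t + (omega ^ 2 + a ^ 2 / 4) * z t)))); [unfold e; lra| |].
    - intros t Ht. pose proof (Hz t Ht) as H1. pose proof (Hv t Ht) as H2. unfold W, E.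
      auto_derive; [repeat split; eexists; eassumption|].
      use_derive H1. use_derive H2. unfold Rminus. field.
    - intros t Ht. specialize (Hw t Ht).
      assert (Hs : 0 <= sin (omega * (t - s))).
      { apply sin_ge_0; [nra|].
        replace PI with (omega * (PI / omega)) by (field; lra).
        apply Rmult_le_compat_l; unfold e in Ht; lra. }
      assert (0 < E t) by apply exp_pos.
      assert (sin (omega * (t - s)) * (w t + a * v t + (omega ^ 2 + a ^ 2 / 4) * z t) <= 0) by nra.
      nra. }
  unfold W in H. replace (s - s) with 0 in H by ring.
  replace (omega * (e - s)) with PI in H by (unfold e; field; lra).
  rewrite Rmult_0_r, sin_PI, cos_PI, sin_0, cos_0 in H.
  assert (0 < E e) by apply exp_pos. assert (0 < E s) by apply exp_pos.
  pose proof (Hpos s ltac:(unfold e; lra)). pose proof (Hpos e ltac:(unfold e; lra)).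
  assert (0 < E e * (z e * omega)) by (repeat apply Rmult_lt_0_compat; trivial).
  assert (0 < E s * (z s * omega)) by (repeat apply Rmult_lt_0_compat; trivial).
  lra.
Qed.

Lemma zero_of_sign_change (z : R -> R) (x y : R) : x < y ->
  (forall t, x <= t <= y -> continuous z t) -> z x * z y <= 0 ->
  exists t, x <= t <= y /\ z t = 0.
Proof.
  intros Hxy Hc Hs.
  destruct (Req_dec (z x) 0) as [Hx|Hx]; [exists x; split; [lra|trivial]|].
  destruct (Req_dec (z y) 0) as [Hy|Hy]; [exists y; split; [lra|trivial]|].
  destruct (Rlt_dec (z x) 0) as [Hxn|Hxp].
  - destruct (Ranalysis5.IVT_interv z x y) as [t [Ht Hzt]]; [|trivial|trivial|nra|now exists t].
    intros t Ht. apply continuity_pt_filterlim, Hc, Ht.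
  - destruct (Ranalysis5.IVT_interv (fun t => - z t) x y) as [t [Ht Hzt]]; [|trivial|nra|nra|].
    + intros t Ht. apply continuity_pt_opp, continuity_pt_filterlim, Hc, Ht.
    + exists t; split; [trivial|lra].
Qed.

Lemma zero_or_sign (z : R -> R) (s e : R) :
  (forall t, s <= t <= e -> continuous z t) ->
  (exists t, s <= t <= e /\ z t = 0) \/
  (forall t, s <= t <= e -> 0 < z t) \/ (forall t, s <= t <= e -> 0 < - z t).
Proof.
  intros Hc.
  destruct (classic (exists t, s <= t <= e /\ z t = 0)) as [|Hno]; [now left|right].
  assert (Hsame : forall t1 t2, s <= t1 <= e -> s <= t2 <= e -> t1 < t2 -> 0 < z t1 * z t2).
  { intros t1 t2 Ht1 Ht2 Hlt. apply Rnot_le_lt; intros Hle. apply Hno.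
    destruct (zero_of_sign_change z t1 t2 Hlt) as [t [Ht Hzt]]; [|trivial|].
    - intros t Ht; apply Hc; lra.
    - exists t; split; [lra|trivial]. }
  assert (Hne : forall t, s <= t <= e -> z t <> 0).
  { intros t Ht Hz. apply Hno. now exists t. }
  destruct (Rlt_dec 0 (z s)) as [Hp|Hn]; [left|right]; intros t Ht;
    (destruct (Req_dec t s) as [->|Hts]; [specialize (Hne s Ht); lra|]);
    specialize (Hsame s t ltac:(lra) Ht ltac:(lra)); [nra|].
  specialize (Hne s ltac:(lra)). nra.
Qed.

Section Oscillation.

Variables (L p a omega x0 : R) (kappa g : R -> R).
Hypotheses (L_pos : 0 < L) (p_gt1 : 1 < p) (omega_pos : 0 < omega) (x0_pos : 0 < x0)
  (oscillatory : omega ^ 2 + a ^ 2 / 4 <= L * (p * (x0 * Q p x0)) - L).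

Lemma power_difference (y1 y2 : R) : x0 <= y1 <= y2 ->
  p * Q p x0 * (y2 - y1) <= y2 * Q p y2 - y1 * Q p y1.
Proof.
  intros H.
  enough (y1 * Q p y1 - p * Q p x0 * y1 <= y2 * Q p y2 - p * Q p x0 * y2) by lra.
  apply (increasing_of_derive (fun y => y * Q p y - p * Q p x0 * y)
           (fun y => p * Q p y - p * Q p x0)); [lra| |].
  - intros t Ht. pose proof (is_derive_Q p t ltac:(lra)) as HQ.
    auto_derive; [eexists; exact HQ|]. use_derive HQ. field. lra.
  - intros t Ht. pose proof (Q_le p p_gt1 x0 t ltac:(lra)). nra.
Qed.

(** The error is split so that [g], common to both solutions, cancels in their difference, while
    [kappa] multiplies the power and needs only a lower bound. *)
Definition perturbed (y z : R -> R) (t : R) : Prop :=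
  is_derive y t (z t) /\
  is_derive z t (- a * z t - force L p (y t) - (L * (kappa t - 1) * (y t * Q p (y t)) + g t)).

(** The difference [z] satisfies [z'' + a z' = L z - L kappa D], where [D], the difference of the
    [p]-th powers, is at least [p Q(x0) z]. With [kappa >= x0] this is the differential inequality
    of [sturm_zero_free]. *)
Lemma no_separation (y1 z1 y2 z2 : R -> R) (s : R) :
  (forall t, s <= t <= s + PI / omega -> perturbed y1 z1 t /\ perturbed y2 z2 t) ->
  (forall t, s <= t <= s + PI / omega -> x0 <= y1 t /\ x0 <= kappa t) ->
  (forall t, s <= t <= s + PI / omega -> 0 < y2 t - y1 t) -> False.
Proof.
  intros Hp Hx Hpos.
  apply (sturm_zero_free a omega s (fun t => y2 t - y1 t) (fun t => z2 t - z1 t)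
    (fun t => (- a * z2 t - force L p (y2 t) - (L * (kappa t - 1) * (y2 t * Q p (y2 t)) + g t))
            - (- a * z1 t - force L p (y1 t) - (L * (kappa t - 1) * (y1 t * Q p (y1 t)) + g t))));
    trivial.
  - intros t Ht. destruct (Hp t Ht) as [[H1 _] [H2 _]]. apply (is_derive_minus y2 y1); trivial.
  - intros t Ht. destruct (Hp t Ht) as [[_ H1] [_ H2]]. apply (is_derive_minus z2 z1); trivial.
  - intros t Ht. specialize (Hpos t Ht). destruct (Hx t Ht) as [Hy1 Hk].
    pose proof (power_difference (y1 t) (y2 t) ltac:(lra)) as Hd.
    pose proof (Q_pos p x0).
    set (D := y2 t * Q p (y2 t) - y1 t * Q p (y1 t)) in *.
    assert (Hm : x0 * (p * Q p x0 * (y2 t - y1 t)) <= kappa t * D).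
    { apply Rmult_le_compat; trivial; [lra|].
      apply Rmult_le_pos; [|lra]. apply Rmult_le_pos; lra. }
    assert (HLm : L * (x0 * (p * Q p x0 * (y2 t - y1 t))) <= L * (kappa t * D))
      by (apply Rmult_le_compat_l; lra).
    assert (Ho : (omega ^ 2 + a ^ 2 / 4) * (y2 t - y1 t) <=
                 (L * (p * (x0 * Q p x0)) - L) * (y2 t - y1 t))
      by (apply Rmult_le_compat_r; lra).
    unfold force, D in *. lra.
Qed.

Lemma common_value (y1 z1 y2 z2 : R -> R) (s : R) :
  (forall t, s <= t <= s + PI / omega -> perturbed y1 z1 t /\ perturbed y2 z2 t) ->
  (forall t, s <= t <= s + PI / omega -> x0 <= y1 t /\ x0 <= y2 t /\ x0 <= kappa t) ->
  exists t, s <= t <= s + PI / omega /\ y1 t = y2 t.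
Proof.
  intros Hp Hx.
  destruct (zero_or_sign (fun t => y2 t - y1 t) s (s + PI / omega)) as [[t [Ht Hz]]|[Hs|Hs]].
  - intros t Ht. destruct (Hp t Ht) as [[H1 _] [H2 _]].
    apply (continuous_minus y2 y1); apply ex_derive_continuous; eexists; eassumption.
  - exists t; split; trivial; lra.
  - exfalso. apply (no_separation y1 z1 y2 z2 s); trivial.
    intros t Ht. specialize (Hx t Ht); tauto.
  - exfalso. apply (no_separation y2 z2 y1 z1 s).
    + intros t Ht. specialize (Hp t Ht); tauto.
    + intros t Ht. specialize (Hx t Ht); tauto.
    + intros t Ht. specialize (Hs t Ht); lra.
Qed.

End Oscillation.

(** * Linear differential inequalities near minus infinity *)

Lemma nonpos_of_exp_bound (x C kappa T : R) :
  0 < kappa -> (forall s, s <= T -> x <= C * exp (kappa * s)) -> x <= 0.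
Proof.
  intros Hk H. apply Rnot_lt_le; intros Hx.
  set (D := Rabs C + 1). assert (HD : 0 < D) by (unfold D; pose proof (Rabs_pos C); lra).
  set (s := Rmin T (ln (x / (2 * D)) / kappa)).
  specialize (H s (Rmin_l _ _)).
  assert (Hs : kappa * s <= ln (x / (2 * D))).
  { replace (ln (x / (2 * D))) with (kappa * (ln (x / (2 * D)) / kappa)) by (field; lra).
    apply Rmult_le_compat_l; [lra|apply Rmin_r]. }
  apply exp_le_mono in Hs. rewrite exp_ln in Hs by (apply Rdiv_lt_0_compat; lra).
  pose proof (exp_pos (kappa * s)). pose proof (Rle_abs C).
  assert (C * exp (kappa * s) <= D * (x / (2 * D))).
  { apply Rle_trans with (D * exp (kappa * s)).
    - apply Rmult_le_compat_r; [lra|unfold D; lra].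
    - apply Rmult_le_compat_l; lra. }
  replace (D * (x / (2 * D))) with (x / 2) in * by (field; lra). lra.
Qed.

(** Variation of constants from [-oo]: the last hypothesis removes the homogeneous mode
    [exp (- m t)], and each exponential source contributes its particular solution. Two sources are
    allowed, one for the nonlinearity and one for [phi]. *)
Lemma linear_upper_bound (P h : R -> R) (m T c1 b1 c2 b2 : R) :
  0 < m -> 0 < b1 -> 0 < b2 -> 0 <= c1 -> 0 <= c2 ->
  (forall t, t <= T -> is_derive P t (- m * P t + h t)) ->
  (forall t, t <= T -> h t <= c1 * exp (b1 * t) + c2 * exp (b2 * t)) ->
  (forall e T', 0 < e -> exists s, s <= T' /\ exp (m * s) * P s <= e) ->
  forall t, t <= T -> P t <= c1 / (m + b1) * exp (b1 * t) + c2 / (m + b2) * exp (b2 * t).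
Proof.
  intros Hm Hb1 Hb2 Hc1 Hc2 Hd Hh Hlim t Ht.
  set (W := fun s => exp (m * s) *
              (P s - (c1 / (m + b1) * exp (b1 * s) + c2 / (m + b2) * exp (b2 * s)))).
  assert (HW : forall s, s <= t -> W t <= W s).
  { intros s Hs. apply (decreasing_of_derive W (fun s => exp (m * s) *
       (h s - (c1 * exp (b1 * s) + c2 * exp (b2 * s))))); trivial.
    - intros v Hv. pose proof (Hd v ltac:(lra)) as H1. unfold W.
      auto_derive; [eexists; exact H1|]. use_derive H1. field. lra.
    - intros v Hv. pose proof (Hh v ltac:(lra)). pose proof (exp_pos (m * v)). nra. }
  assert (Hneg : W t <= 0).
  { apply Rnot_lt_le; intros Hpos.
    destruct (Hlim (W t / 2) t ltac:(lra)) as [s [Hs Hle]].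
    specialize (HW s Hs). unfold W at 2 in HW.
    pose proof (exp_pos (m * s)). pose proof (exp_pos (b1 * s)). pose proof (exp_pos (b2 * s)).
    assert (0 <= c1 / (m + b1)) by (apply Rdiv_le_0_compat; lra).
    assert (0 <= c2 / (m + b2)) by (apply Rdiv_le_0_compat; lra).
    assert (0 <= c1 / (m + b1) * exp (b1 * s) + c2 / (m + b2) * exp (b2 * s)) by nra.
    nra. }
  unfold W in Hneg. pose proof (exp_pos (m * t)). nra.
Qed.

Lemma integrated_upper_bound (U P : R -> R) (T c1 b1 c2 b2 : R) :
  0 < b1 -> 0 < b2 -> 0 <= c1 -> 0 <= c2 ->
  (forall t, t <= T -> is_derive U t (- P t)) ->
  (forall t, t <= T -> P t <= c1 * exp (b1 * t) + c2 * exp (b2 * t)) ->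
  forall s t, s <= t -> t <= T ->
  U s <= U t + (c1 / b1 * exp (b1 * t) + c2 / b2 * exp (b2 * t)).
Proof.
  intros Hb1 Hb2 Hc1 Hc2 Hd HP s t Hst Ht.
  assert (H : U s + (c1 / b1 * exp (b1 * s) + c2 / b2 * exp (b2 * s)) <=
              U t + (c1 / b1 * exp (b1 * t) + c2 / b2 * exp (b2 * t))).
  { apply (increasing_of_derive
      (fun s => U s + (c1 / b1 * exp (b1 * s) + c2 / b2 * exp (b2 * s)))
      (fun s => - P s + (c1 * exp (b1 * s) + c2 * exp (b2 * s)))); trivial.
    - intros v Hv. pose proof (Hd v ltac:(lra)) as H1.
      auto_derive; [eexists; exact H1|]. use_derive H1. field. lra.
    - intros v Hv. pose proof (HP v ltac:(lra)). lra. }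
  assert (0 <= c1 / b1) by (apply Rdiv_le_0_compat; lra).
  assert (0 <= c2 / b2) by (apply Rdiv_le_0_compat; lra).
  pose proof (exp_pos (b1 * s)). pose proof (exp_pos (b2 * s)). nra.
Qed.

(** * The radial equation in logarithmic time *)

(* With [t = ln r], [U t = u r] and [P t = - r u'(r)], the equation is [U' = - P],
   [P' = - n P + k exp (beta t) U ^ p + phi], where [n = N - 2], [beta = 2 + alpha],
   [k t = K r / r ^ alpha] and [phi t = mu r ^ 2 f r]. *)
Section Radial.

Variables (n beta p k0 sigma C T0 : R) (k phi : R -> R).
Hypotheses (n_pos : 0 < n) (beta_pos : 0 < beta) (p_gt1 : 1 < p) (k0_pos : 0 < k0)
  (sigma_pos : 0 < sigma) (C_nonneg : 0 <= C).

Definition theta : R := beta / (p - 1).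

Hypothesis supercritical : 2 * theta < n.

Definition lin_coef : R := theta * (n - theta).
Definition friction : R := n - 2 * theta.
(** The function [amplitude * r ^ (- theta)] is the exact singular solution for [K r = k0 r ^ alpha]
    and [mu = 0]; dividing by it puts the equilibrium at [1]. *)
Definition amplitude : R := Rpower (lin_coef / k0) (/ (p - 1)).

Hypotheses (k_pos : forall t, 0 < k t)
  (k_lim : forall eps, 0 < eps -> exists T, forall t, t <= T -> Rabs (k t - k0) <= eps)
  (phi_nonneg : forall t, 0 <= phi t)
  (phi_le : forall t, t <= T0 -> phi t <= C * exp (sigma * t)).

Definition scaled (U : R -> R) (t : R) : R := exp (theta * t) * U t / amplitude.
Definition scaled_slope (U P : R -> R) (t : R) : R :=
  theta * scaled U t - exp (theta * t) * P t / amplitude.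
(** The error of the planar system. It depends on [y] through the defect of [k], hence tends to [0]
    uniformly only for bounded [y]. *)
Definition perturbation (y t : R) : R :=
  lin_coef * (k t / k0 - 1) * (y * Q p y) + exp (theta * t) * phi t / amplitude.

Lemma theta_pos : 0 < theta.
Proof. apply Rdiv_lt_0_compat; lra. Qed.

Lemma lin_coef_pos : 0 < lin_coef.
Proof. pose proof theta_pos. unfold lin_coef. nra. Qed.

Lemma friction_pos : 0 < friction.
Proof. unfold friction; lra. Qed.

Lemma amplitude_pos : 0 < amplitude.
Proof. apply exp_pos. Qed.

Lemma Q_amplitude : Q p amplitude = lin_coef / k0.
Proof.
  unfold Q, amplitude. rewrite Rpower_mult, Rinv_l by lra.
  apply Rpower_1, Rdiv_lt_0_compat; [apply lin_coef_pos|trivial].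
Qed.

Lemma Q_mult (x y : R) : 0 < x -> 0 < y -> Q p (x * y) = Q p x * Q p y.
Proof. intros Hx Hy; unfold Q; symmetry; now apply Rpower_mult_distr. Qed.

Lemma Q_exp (t : R) : Q p (exp (theta * t)) = exp (beta * t).
Proof.
  unfold Q, Rpower. rewrite ln_exp. f_equal. unfold theta. field; lra.
Qed.

Lemma Q_scaled (U : R -> R) (t : R) : 0 < U t ->
  lin_coef * Q p (scaled U t) = k0 * (exp (beta * t) * Q p (U t)).
Proof.
  intros HU. pose proof amplitude_pos as HA. pose proof lin_coef_pos as HL.
  assert (Hs : scaled U t * amplitude = exp (theta * t) * U t) by (unfold scaled; field; lra).
  assert (Hp : 0 < scaled U t).
  { unfold scaled. pose proof (exp_pos (theta * t)).
    apply Rdiv_lt_0_compat; [apply Rmult_lt_0_compat|]; lra. }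
  apply (f_equal (Q p)) in Hs.
  rewrite !Q_mult, Q_exp, Q_amplitude in Hs by (trivial; apply exp_pos).
  rewrite <- Hs. field; lra.
Qed.

Lemma scaled_pos (U : R -> R) (t : R) : 0 < U t <-> 0 < scaled U t.
Proof.
  pose proof amplitude_pos as HA. pose proof (exp_pos (theta * t)) as He.
  assert (Hs : scaled U t = U t * (exp (theta * t) / amplitude)) by (unfold scaled; field; lra).
  assert (Hp : 0 < exp (theta * t) / amplitude) by (apply Rdiv_lt_0_compat; lra).
  rewrite Hs. split; intros H; nra.
Qed.

Lemma Rpower_Q (x : R) : 0 < x -> Rpower x p = x * Q p x.
Proof.
  intros Hx. replace p with (1 + (p - 1)) at 1 by ring.
  rewrite Rpower_plus, Rpower_1 by trivial. reflexivity.
Qed.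

Lemma is_derive_scaled (U P : R -> R) (t : R) :
  is_derive U t (- P t) -> is_derive (scaled U) t (scaled_slope U P t).
Proof.
  intros HU. unfold scaled_slope, scaled. pose proof amplitude_pos.
  auto_derive; [eexists; exact HU|]. use_derive HU. field; lra.
Qed.

Lemma is_derive_scaled_slope (U P : R -> R) (t : R) :
  0 < U t -> is_derive U t (- P t) ->
  is_derive P t (- n * P t + (k t * exp (beta * t) * Rpower (U t) p + phi t)) ->
  is_derive (scaled_slope U P) t
    (- friction * scaled_slope U P t - force lin_coef p (scaled U t)
     - perturbation (scaled U t) t).
Proof.
  intros Hpos HU HP. pose proof amplitude_pos as HA.
  assert (Hval : - friction * scaled_slope U P t - force lin_coef p (scaled U t)
     - perturbation (scaled U t) t =
     theta * scaled_slope U P t - (theta * exp (theta * t) * P t / amplitude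
       + exp (theta * t) / amplitude *
         (- n * P t + (k t * exp (beta * t) * Rpower (U t) p + phi t)))).
  { rewrite Rpower_Q by trivial. unfold force, perturbation, friction.
    replace (lin_coef * scaled U t * (Q p (scaled U t) - 1))
      with (scaled U t * (lin_coef * Q p (scaled U t)) - lin_coef * scaled U t) by ring.
    replace (lin_coef * (k t / k0 - 1) * (scaled U t * Q p (scaled U t)))
      with ((k t / k0 - 1) * scaled U t * (lin_coef * Q p (scaled U t))) by ring.
    rewrite Q_scaled by trivial. unfold scaled_slope, lin_coef, scaled. field; lra. }
  rewrite Hval. clear Hval.
  pose proof (is_derive_scaled U P t HU) as Hs.
  unfold scaled_slope at 1.
  auto_derive; [repeat split; eexists; eassumption|].
  use_derive Hs. use_derive HP. field; lra.
Qed.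

Lemma perturbation_small (M eps : R) : 0 < M -> 0 < eps ->
  exists T, forall t y, t <= T -> 0 < y <= M -> Rabs (perturbation y t) <= eps.
Proof.
  intros HM He. pose proof amplitude_pos as HA. pose proof lin_coef_pos as HL.
  set (D := lin_coef * (M * Q p M) / k0).
  assert (HD : 0 < D).
  { pose proof (Q_pos p M). apply Rdiv_lt_0_compat; trivial.
    apply Rmult_lt_0_compat; [|apply Rmult_lt_0_compat]; lra. }
  destruct (k_lim (eps / (2 * D))) as [T1 HT1]; [apply Rdiv_lt_0_compat; lra|].
  pose proof theta_pos as Hth.
  set (X := amplitude * eps / (2 * (C + 1))).
  assert (HX : 0 < X) by (unfold X; apply Rdiv_lt_0_compat; [apply Rmult_lt_0_compat|]; lra).
  exists (Rmin T1 (Rmin T0 (ln X / (theta + sigma)))).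
  intros t y Ht Hy.
  pose proof (Rmin_l T1 (Rmin T0 (ln X / (theta + sigma)))).
  pose proof (Rmin_r T1 (Rmin T0 (ln X / (theta + sigma)))).
  pose proof (Rmin_l T0 (ln X / (theta + sigma))).
  pose proof (Rmin_r T0 (ln X / (theta + sigma))).
  unfold perturbation. eapply Rle_trans; [apply Rabs_triang|].
  replace eps with (eps / 2 + eps / 2) by field. apply Rplus_le_compat.
  - specialize (HT1 t ltac:(lra)).
    replace (lin_coef * (k t / k0 - 1) * (y * Q p y))
      with ((k t - k0) * (lin_coef * (y * Q p y) / k0)) by (field; lra).
    replace (eps / 2) with (eps / (2 * D) * D) by (field; lra).
    pose proof (Q_pos p y). pose proof (Q_le p p_gt1 y M Hy).
    assert (H5 : 0 <= y * Q p y <= M * Q p M) by (split; [nra|apply Rmult_le_compat; lra]).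
    assert (H6 : 0 <= lin_coef * (y * Q p y) / k0 <= D).
    { split; [apply Rdiv_le_0_compat; nra|]. unfold D.
      apply Rmult_le_compat_r; [left; apply Rinv_0_lt_compat; lra|].
      apply Rmult_le_compat_l; lra. }
    rewrite Rabs_mult, (Rabs_right (_ / k0)) by lra.
    apply Rmult_le_compat; [apply Rabs_pos|lra|lra|lra].
  - specialize (phi_le t ltac:(lra)). pose proof (phi_nonneg t).
    pose proof (exp_pos (theta * t)).
    rewrite Rabs_right.
    2:{ apply Rle_ge, Rdiv_le_0_compat; [|lra]. nra. }
    assert (H5 : exp ((theta + sigma) * t) <= X).
    { rewrite <- (exp_ln X HX). apply exp_le_mono.
      replace (ln X) with ((theta + sigma) * (ln X / (theta + sigma))) by (field; lra).
      apply Rmult_le_compat_l; lra. }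
    assert (H6 : exp (theta * t) * phi t <= (C + 1) * X).
    { apply Rle_trans with (C * exp ((theta + sigma) * t)).
      - rewrite Rmult_plus_distr_r, exp_plus. nra.
      - pose proof (exp_pos ((theta + sigma) * t)). nra. }
    replace (eps / 2) with ((C + 1) * X / amplitude) by (unfold X; field; lra).
    apply Rmult_le_compat_r; [left; apply Rinv_0_lt_compat|]; lra.
Qed.

(** * Singular solutions converge to the equilibrium *)

Section Singular.

Variables (U P : R -> R) (Ts : R).
Hypotheses (U_pos : forall t, t < Ts -> 0 < U t)
  (dU : forall t, t < Ts -> is_derive U t (- P t))
  (dP : forall t, t < Ts ->
    is_derive P t (- n * P t + (k t * exp (beta * t) * Rpower (U t) p + phi t)))
  (U_blowup : forall X, exists T, forall t, t <= T -> X <= U t).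

Lemma source_nonneg (t : R) : 0 <= k t * exp (beta * t) * Rpower (U t) p + phi t.
Proof.
  pose proof (k_pos t). pose proof (exp_pos (beta * t)). pose proof (phi_nonneg t).
  assert (0 < Rpower (U t) p) by apply exp_pos.
  assert (0 < k t * exp (beta * t) * Rpower (U t) p); [|lra].
  apply Rmult_lt_0_compat; [apply Rmult_lt_0_compat|]; trivial.
Qed.

(** In the radial variable [exp (n t) P] is [- r ^ (N - 1) u'], whose growth is driven by the
    nonnegative source. *)
Lemma is_derive_flux (t : R) : t < Ts -> is_derive (fun s => exp (n * s) * P s) t
    (exp (n * t) * (k t * exp (beta * t) * Rpower (U t) p + phi t)).
Proof.
  intros Ht. pose proof (dP t Ht) as HP.
  auto_derive; [eexists; exact HP|]. use_derive HP. ring.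
Qed.

Lemma flux_increasing (s t : R) : s <= t -> t < Ts -> exp (n * s) * P s <= exp (n * t) * P t.
Proof.
  intros Hst Ht.
  apply (increasing_of_derive (fun s => exp (n * s) * P s)
    (fun t => exp (n * t) * (k t * exp (beta * t) * Rpower (U t) p + phi t))); trivial.
  - intros v Hv. apply is_derive_flux; lra.
  - intros v Hv. pose proof (source_nonneg v). pose proof (exp_pos (n * v)). nra.
Qed.

(** If [P] were negative at [t], monotonicity of the flux would make it negative at all earlier
    times, so [U] would stay below [U t] as time goes to [-oo], against the blow-up. *)
Lemma singular_slope_nonneg (t : R) : t < Ts -> 0 <= P t.
Proof.
  intros Ht. apply Rnot_lt_le; intros Hneg.
  assert (Hs : forall s, s <= t -> P s < 0).
  { intros s Hs. pose proof (flux_increasing s t Hs Ht).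
    pose proof (exp_pos (n * s)). pose proof (exp_pos (n * t)). nra. }
  destruct (U_blowup (U t + 1)) as [T HT].
  pose proof (Rmin_l T t). pose proof (Rmin_r T t).
  specialize (HT (Rmin T t) ltac:(lra)).
  assert (U (Rmin T t) <= U t); [|lra].
  apply (increasing_of_derive U (fun s => - P s)); trivial.
  - intros v Hv; apply dU; lra.
  - intros v Hv. specialize (Hs v ltac:(lra)). lra.
Qed.

Lemma singular_decreasing (s t : R) : s <= t -> t < Ts -> U t <= U s.
Proof.
  intros Hst Ht. apply (decreasing_of_derive U (fun s => - P s)); trivial.
  - intros v Hv; apply dU; lra.
  - intros v Hv. pose proof (singular_slope_nonneg v ltac:(lra)). lra.
Qed.

(** By monotonicity of the flux, [P >= exp (- n) * P t] on [[t, t + 1]]; [U] drops by at least that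
    amount there and is still positive at the end. *)
Lemma singular_slope_le (t : R) : t < Ts - 1 -> P t <= exp n * U t.
Proof.
  intros Ht. pose proof (exp_pos n) as Hn.
  pose proof (singular_slope_nonneg t ltac:(lra)) as HPt.
  assert (H : U (t + 1) + exp (- n) * P t * (t + 1) <= U t + exp (- n) * P t * t).
  { apply (decreasing_of_derive (fun s => U s + exp (- n) * P t * s)
             (fun s => - P s + exp (- n) * P t)); [lra| |].
    - intros v Hv. pose proof (dU v ltac:(lra)) as HU.
      auto_derive; [eexists; exact HU|]. use_derive HU. ring.
    - intros v Hv. pose proof (flux_increasing t v ltac:(lra) ltac:(lra)) as Hf.
      pose proof (singular_slope_nonneg v ltac:(lra)) as HPv.
      assert (H1 : exp (- n) * exp (n * v) <= exp (n * t)).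
      { rewrite <- exp_plus. apply exp_le_mono. nra. }
      pose proof (exp_pos (n * v)). pose proof (exp_pos (- n)).
      assert (H2 : exp (n * v) * (exp (- n) * P t) <= exp (n * v) * P v).
      { apply Rle_trans with (exp (n * t) * P t); trivial.
        replace (exp (n * v) * (exp (- n) * P t)) with (exp (- n) * exp (n * v) * P t) by ring.
        apply Rmult_le_compat_r; trivial. }
      apply Rmult_le_reg_l in H2; trivial. lra. }
  pose proof (U_pos (t + 1) ltac:(lra)).
  assert (H1 : exp (- n) * P t <= U t) by lra.
  assert (H2 : exp n * exp (- n) = 1) by (rewrite <- exp_plus, <- exp_0; f_equal; ring).
  apply (Rmult_le_compat_l (exp n)) in H1; [|lra].
  rewrite <- Rmult_assoc, H2 in H1. lra.
Qed.

(** As [U] is nonincreasing, integrating the flux over a unit interval gives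
    [P >= c1 exp (beta t) U ^ p], a lower bound for the derivative of [U ^ (1 - p)]. A second unit
    interval bounds [U ^ (1 - p)] below by a multiple of [exp (beta t)]. *)
Lemma singular_scaled_bounded : exists X T, 0 < X /\ T < Ts /\
  forall t, t <= T -> Q p (scaled U t) <= X.
Proof.
  destruct (k_lim (k0 / 2) ltac:(lra)) as [T1 HT1].
  set (c1 := exp (- n - beta) * (k0 / 2)).
  assert (Hc1 : 0 < c1) by (unfold c1; pose proof (exp_pos (- n - beta)); nra).
  set (T := Rmin T1 (Ts - 1)).
  assert (HTa : T <= T1) by apply Rmin_l. assert (HTb : T <= Ts - 1) by apply Rmin_r.
  assert (HP : forall t, t <= T -> c1 * exp (beta * t) * Rpower (U t) p <= P t).
  { intros t Ht. set (Up := Rpower (U t) p). assert (HUp : 0 < Up) by apply exp_pos.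
    set (c := exp (n * (t - 1)) * (k0 / 2 * exp (beta * (t - 1)) * Up)).
    assert (H : exp (n * (t - 1)) * P (t - 1) - c * (t - 1) <= exp (n * t) * P t - c * t).
    { apply (increasing_of_derive (fun s => exp (n * s) * P s - c * s)
        (fun t => exp (n * t) * (k t * exp (beta * t) * Rpower (U t) p + phi t) - c)); [lra| |].
      - intros v Hv. apply (is_derive_minus (fun s => exp (n * s) * P s) (fun s => c * s)).
        + apply is_derive_flux; lra.
        + auto_derive; trivial; ring.
      - intros v Hv.
        assert (H1 : c <= exp (n * v) * (k v * exp (beta * v) * Rpower (U v) p + phi v)); [|lra].
        pose proof (exp_pos (n * (t - 1))). pose proof (exp_pos (beta * (t - 1))).
        assert (exp (n * (t - 1)) <= exp (n * v)) by (apply exp_le_mono; nra).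
        assert (H2 : exp (beta * (t - 1)) <= exp (beta * v)) by (apply exp_le_mono; nra).
        specialize (HT1 v ltac:(lra)). apply Rabs_le_between in HT1.
        assert (H3 : Up <= Rpower (U v) p).
        { apply Rle_Rpower_l; [lra|]. split; [apply U_pos; lra|].
          apply singular_decreasing; lra. }
        pose proof (phi_nonneg v).
        assert (Hkb : k0 / 2 * exp (beta * (t - 1)) <= k v * exp (beta * v))
          by (apply Rmult_le_compat; lra).
        assert (0 <= k0 / 2 * exp (beta * (t - 1))) by nra.
        assert (Hku : k0 / 2 * exp (beta * (t - 1)) * Up <= k v * exp (beta * v) * Rpower (U v) p)
          by (apply Rmult_le_compat; lra).
        unfold c. apply Rmult_le_compat; nra. }
    pose proof (singular_slope_nonneg (t - 1) ltac:(lra)) as HP0.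
    pose proof (exp_pos (n * (t - 1))).
    assert (Hc : c <= exp (n * t) * P t) by nra.
    apply Rmult_le_reg_l with (exp (n * t)); [apply exp_pos|].
    eapply Rle_trans; [right|exact Hc]. unfold c, c1.
    replace (exp (n * (t - 1))) with (exp (n * t) * exp (- n)) by
      (rewrite <- exp_plus; f_equal; ring).
    replace (exp (beta * (t - 1))) with (exp (beta * t) * exp (- beta)) by
      (rewrite <- exp_plus; f_equal; ring).
    replace (exp (- n - beta)) with (exp (- n) * exp (- beta)) by
      (rewrite <- exp_plus; f_equal; ring). ring. }
  set (c2 := (p - 1) * (c1 * exp (- beta))).
  assert (Hc2 : 0 < c2).
  { unfold c2. apply Rmult_lt_0_compat; [lra|]. apply Rmult_lt_0_compat; [lra|apply exp_pos]. }
  exists (k0 / (c2 * lin_coef)), T. pose proof lin_coef_pos as HL.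
  assert (HcL : 0 < c2 * lin_coef) by (apply Rmult_lt_0_compat; lra).
  split; [apply Rdiv_lt_0_compat; lra|]. split; [lra|]. intros t Ht.
  assert (Hd : forall v, v < Ts -> is_derive (fun s => / Q p (U s)) v
             ((p - 1) * P v / (U v * Q p (U v)))).
  { intros v Hv. pose proof (U_pos v Hv) as HUv. pose proof (Q_pos p (U v)).
    pose proof (is_derive_comp _ _ _ _ _ (is_derive_Q p (U v) HUv) (dU v Hv)) as HQ.
    unfold scal in HQ; simpl in HQ; unfold mult in HQ; simpl in HQ.
    set (q := fun s => Q p (U s)) in *.
    change (is_derive (fun s => / q s) v ((p - 1) * P v / (U v * q v))).
    assert (q v <> 0) by (unfold q; lra).
    auto_derive; [split; [eexists; exact HQ|split; trivial]|].
    use_derive HQ. change (Q p (U v)) with (q v). field. split; lra. }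
  assert (H : / Q p (U (t - 1)) - c2 * exp (beta * t) * (t - 1)
                <= / Q p (U t) - c2 * exp (beta * t) * t).
  { apply (increasing_of_derive (fun s => / Q p (U s) - c2 * exp (beta * t) * s)
      (fun v => (p - 1) * P v / (U v * Q p (U v)) - c2 * exp (beta * t))); [lra| |].
    - intros v Hv. apply (is_derive_minus (fun s => / Q p (U s)) (fun s => c2 * exp (beta * t) * s)).
      + apply Hd; lra.
      + auto_derive; trivial; ring.
    - intros v Hv. specialize (HP v ltac:(lra)). pose proof (U_pos v ltac:(lra)).
      rewrite Rpower_Q in HP by trivial. pose proof (Q_pos p (U v)).
      assert (Hm : 0 < U v * Q p (U v)) by nra.
      assert (H1 : c1 * exp (beta * v) <= P v / (U v * Q p (U v))).
      { apply Rmult_le_reg_r with (U v * Q p (U v)); trivial.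
        replace (P v / (U v * Q p (U v)) * (U v * Q p (U v))) with (P v) by (field; lra). lra. }
      assert (H2 : exp (- beta) * exp (beta * t) <= exp (beta * v)).
      { rewrite <- exp_plus. apply exp_le_mono. nra. }
      replace ((p - 1) * P v / (U v * Q p (U v))) with ((p - 1) * (P v / (U v * Q p (U v))))
        by (field; lra).
      assert (c2 * exp (beta * t) <= (p - 1) * (P v / (U v * Q p (U v)))); [|lra].
      unfold c2. rewrite Rmult_assoc. apply Rmult_le_compat_l; [lra|].
      eapply Rle_trans; [|exact H1]. rewrite Rmult_assoc. apply Rmult_le_compat_l; lra. }
  assert (Hinv : 0 < / Q p (U (t - 1))) by (apply Rinv_0_lt_compat, Q_pos).
  pose proof (Q_pos p (U t)) as HQt.
  assert (H1 : c2 * exp (beta * t) * Q p (U t) <= 1).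
  { apply Rmult_le_reg_r with (/ Q p (U t)); [apply Rinv_0_lt_compat; lra|].
    rewrite Rmult_assoc, Rinv_r by lra. lra. }
  pose proof (Q_scaled U t (U_pos t ltac:(lra))) as Hsc.
  apply Rmult_le_reg_l with (c2 * lin_coef); [lra|].
  replace (c2 * lin_coef * (k0 / (c2 * lin_coef))) with k0 by (field; lra).
  rewrite Rmult_assoc, Hsc. nra.
Qed.

(** If [scaled U] stayed below a small [y1], the nonlinearity would be dominated by [eps * U]. This
    improves the growth of [U] to [O(exp (- d t))] with [d] so small that the source
    [exp (beta t) U ^ p] decays exponentially; then so does [P], and [U] is bounded, against the
    blow-up. *)
Lemma singular_not_small : exists y1, 0 < y1 /\
  forall T, exists t, t <= T /\ y1 <= scaled U t.
Proof.
  pose proof lin_coef_pos as HL. pose proof amplitude_pos as HA. pose proof theta_pos as Hth.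
  (* With [theta < n / 2], the bound [n / 4] makes [n - d - theta] positive, which discards
     homogeneous modes; the other bound makes [beta - p * d] positive. *)
  set (d := Rmin (n / 4) (beta / (2 * p))).
  assert (Hd : 0 < d) by (apply Rmin_glb_lt; [lra|apply Rdiv_lt_0_compat; lra]).
  assert (Hd1 : d <= n / 4) by apply Rmin_l.
  assert (Hd2 : p * d <= beta / 2).
  { replace (beta / 2) with (p * (beta / (2 * p))) by (field; lra).
    apply Rmult_le_compat_l; [lra|apply Rmin_r]. }
  (* Then [d] is a root of [d ^ 2 - n d + eps], so the linear system with source [eps * U] factors
     through [P - d U]. *)
  set (eps := d * (n - d)). assert (Heps : 0 < eps) by (unfold eps; nra).
  (* The factor [2] allows for [k <= 2 k0]. *)
  destruct (Q_onto p p_gt1 (eps / (2 * lin_coef))) as [y1 [Hy1 HQ1]].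
  { apply Rdiv_lt_0_compat; lra. }
  exists y1; split; trivial. intros T'.
  apply NNPP; intros Hn.
  assert (Hsmall' : forall t, t <= T' -> scaled U t < y1).
  { intros t Ht. apply Rnot_le_lt; intros Hle. apply Hn. exists t; split; trivial. }
  destruct (k_lim k0 k0_pos) as [T1 HT1].
  set (T := Rmin T' (Rmin T1 (Rmin T0 (Ts - 2)))).
  assert (T <= T' /\ T <= T1 /\ T <= T0 /\ T <= Ts - 2) as (HTa & HTb & HTc & HTd).
  { unfold T. pose proof (Rmin_l T' (Rmin T1 (Rmin T0 (Ts - 2)))).
    pose proof (Rmin_r T' (Rmin T1 (Rmin T0 (Ts - 2)))).
    pose proof (Rmin_l T1 (Rmin T0 (Ts - 2))). pose proof (Rmin_r T1 (Rmin T0 (Ts - 2))).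
    pose proof (Rmin_l T0 (Ts - 2)). pose proof (Rmin_r T0 (Ts - 2)). lra. }
  assert (Hk : forall t, t <= T -> 0 < k t <= 2 * k0).
  { intros t Ht. specialize (HT1 t ltac:(lra)). apply Rabs_le_between in HT1.
    split; [apply k_pos|lra]. }
  assert (Hsrc : forall t, t <= T -> k t * exp (beta * t) * Rpower (U t) p + phi t <=
                   eps * U t + C * exp (sigma * t)).
  { intros t Ht. pose proof (U_pos t ltac:(lra)) as HU.
    specialize (phi_le t ltac:(lra)). apply Rplus_le_compat; trivial.
    rewrite Rpower_Q by trivial.
    pose proof (proj1 (scaled_pos U t) HU) as Hs.
    pose proof (Q_le p p_gt1 (scaled U t) y1 (conj Hs (Rlt_le _ _ (Hsmall' t ltac:(lra))))) as HQ.
    pose proof (Q_scaled U t HU) as Hsc. specialize (Hk t Ht).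
    assert (H1 : lin_coef * Q p (scaled U t) <= eps / 2).
    { replace (eps / 2) with (lin_coef * Q p y1) by (rewrite HQ1; field; lra).
      apply Rmult_le_compat_l; lra. }
    assert (H2 : k t * (exp (beta * t) * Q p (U t)) <= eps).
    { pose proof (exp_pos (beta * t)). pose proof (Q_pos p (U t)).
      assert (0 < exp (beta * t) * Q p (U t)) by (apply Rmult_lt_0_compat; lra). nra. }
    nra. }
  assert (HUA : forall t, t <= T -> exp (theta * t) * U t <= amplitude * y1).
  { intros t Ht. pose proof (Hsmall' t ltac:(lra)).
    replace (exp (theta * t) * U t) with (amplitude * scaled U t) by (unfold scaled; field; lra).
    apply Rmult_le_compat_l; lra. }
  assert (HPn : forall t, t <= T -> 0 <= P t <= exp n * U t).
  { intros t Ht. split; [apply singular_slope_nonneg|apply singular_slope_le]; lra. }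
  (* [P - d U] solves a linear inequality whose source is only [phi]. *)
  set (C1 := C / (n - d + sigma)).
  assert (HC1 : 0 <= C1) by (apply Rdiv_le_0_compat; lra).
  assert (Hdecay : forall t, t <= T -> P t - d * U t <= C1 * exp (sigma * t)).
  { intros t Ht.
    (* Only [phi] remains as source, so the first exponential is a dummy with coefficient [0] and
       rate [1]. *)
    enough (P t - d * U t <= 0 / (n - d + 1) * exp (1 * t) + C1 * exp (sigma * t)).
    { replace (0 / (n - d + 1)) with 0 in H by (field; lra). lra. }
    apply (linear_upper_bound (fun s => P s - d * U s)
      (fun s => k s * exp (beta * s) * Rpower (U s) p + phi s - eps * U s) (n - d) T); try lra.
    - intros s Hs. pose proof (dP s ltac:(lra)) as H1. pose proof (dU s ltac:(lra)) as H2.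
      set (h := k s * exp (beta * s) * Rpower (U s) p + phi s) in *.
      auto_derive; [repeat split; eexists; eassumption|].
      use_derive H1. use_derive H2. unfold eps. ring.
    - intros s Hs. specialize (Hsrc s Hs). lra.
    (* Boundedness of [exp (theta s) * U s] and [P <= exp n * U] bound the homogeneous mode by a
       multiple of [exp ((n - d - theta) s)], which tends to [0]. *)
    - intros e T2 He.
      apply NNPP; intros Hno.
      assert (Hbig : e <= 0); [|lra].
      apply (nonpos_of_exp_bound e (exp n * (amplitude * y1)) (n - d - theta) (Rmin T T2));
        [lra|].
      intros s Hs. pose proof (Rmin_l T T2). pose proof (Rmin_r T T2).
      apply Rle_trans with (exp ((n - d) * s) * (P s - d * U s)).
      { apply Rnot_lt_le; intros Hlt. apply Hno. exists s; split; lra. }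
      specialize (HPn s ltac:(lra)). specialize (HUA s ltac:(lra)).
      pose proof (U_pos s ltac:(lra)).
      replace ((n - d) * s) with ((n - d - theta) * s + theta * s) by ring.
      rewrite exp_plus. pose proof (exp_pos ((n - d - theta) * s)).
      pose proof (exp_pos (theta * s)). pose proof (exp_pos n).
      rewrite Rmult_assoc, (Rmult_comm _ (exp ((n - d - theta) * s))).
      apply Rmult_le_compat_l; [lra|].
      apply Rle_trans with (exp n * (exp (theta * s) * U s)).
      + replace (exp n * (exp (theta * s) * U s)) with (exp (theta * s) * (exp n * U s)) by ring.
        apply Rmult_le_compat_l; nra.
      + apply Rmult_le_compat_l; lra. }
  assert (HD : exists D, 0 < D /\ forall t, t <= T -> exp (d * t) * U t <= D).
  { set (D := exp (d * T) * U T + C1 / (sigma + d) * exp ((sigma + d) * T)).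
    exists D. split.
    { unfold D. pose proof (U_pos T ltac:(lra)). pose proof (exp_pos (d * T)).
      pose proof (exp_pos ((sigma + d) * T)).
      assert (0 <= C1 / (sigma + d)) by (apply Rdiv_le_0_compat; lra). nra. }
    intros t Ht.
    enough (exp (d * t) * U t <= exp (d * T) * U T +
             (0 / 1 * exp (1 * T) + C1 / (sigma + d) * exp ((sigma + d) * T))).
    { replace (0 / 1) with 0 in H by field. unfold D. lra. }
    apply (integrated_upper_bound (fun s => exp (d * s) * U s)
             (fun s => exp (d * s) * (P s - d * U s)) T); try lra.
    - intros s Hs. pose proof (dU s ltac:(lra)) as H2.
      auto_derive; [eexists; exact H2|]. use_derive H2. ring.
    - intros s Hs. specialize (Hdecay s Hs).
      replace ((sigma + d) * s) with (d * s + sigma * s) by ring. rewrite exp_plus.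
      pose proof (exp_pos (d * s)). nra. }
  destruct HD as [D [HD HUD]].
  (* The improved growth [U <= D exp (- d t)] turns the nonlinear source into [c1 exp (b1 t)] with
     [b1 > 0]. *)
  set (c1 := 2 * k0 * Rpower D p). set (b1 := beta - p * d).
  assert (Hc1 : 0 < c1) by (unfold c1; assert (0 < Rpower D p) by apply exp_pos; nra).
  assert (Hb1 : 0 < b1) by (unfold b1; lra).
  assert (HPle : forall t, t <= T -> P t <=
             c1 / (n + b1) * exp (b1 * t) + C / (n + sigma) * exp (sigma * t)).
  { apply (linear_upper_bound P
      (fun s => k s * exp (beta * s) * Rpower (U s) p + phi s)); try lra.
    - intros t Ht. apply dP; lra.
    - intros t Ht. specialize (phi_le t ltac:(lra)). apply Rplus_le_compat; trivial.
      pose proof (U_pos t ltac:(lra)) as HU.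
      assert (H1 : exp (beta * t) * Rpower (U t) p <= Rpower D p * exp (b1 * t)).
      { apply Rle_trans with (exp (beta * t) * Rpower (exp (- (d * t)) * D) p).
        - apply Rmult_le_compat_l; [left; apply exp_pos|]. apply Rle_Rpower_l; [lra|].
          split; trivial. specialize (HUD t Ht).
          apply Rmult_le_reg_l with (exp (d * t)); [apply exp_pos|].
          rewrite <- Rmult_assoc, <- exp_plus, Rplus_opp_r, exp_0. lra.
        - right. rewrite <- Rpower_mult_distr by (trivial; apply exp_pos).
          assert (He : Rpower (exp (- (d * t))) p = exp (- (p * d * t))).
          { unfold Rpower. rewrite ln_exp. f_equal; ring. }
          rewrite He. replace (b1 * t) with (beta * t + - (p * d * t)) by (unfold b1; ring).
          rewrite exp_plus. ring. }
      specialize (Hk t Ht). unfold c1.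
      assert (0 < Rpower (U t) p) by apply exp_pos. pose proof (exp_pos (beta * t)).
      rewrite !Rmult_assoc. rewrite <- (Rmult_assoc 2 k0).
      apply Rmult_le_compat; nra.
    - intros e T2 He. apply NNPP; intros Hno.
      assert (Hbig : e <= 0); [|lra].
      apply (nonpos_of_exp_bound e (exp n * D) (n - d) (Rmin T T2)); [lra|].
      intros s Hs. pose proof (Rmin_l T T2). pose proof (Rmin_r T T2).
      apply Rle_trans with (exp (n * s) * P s).
      { apply Rnot_lt_le; intros Hlt. apply Hno. exists s; split; lra. }
      specialize (HPn s ltac:(lra)). specialize (HUD s ltac:(lra)).
      replace (n * s) with ((n - d) * s + d * s) by ring. rewrite exp_plus.
      pose proof (exp_pos ((n - d) * s)). pose proof (exp_pos (d * s)). pose proof (exp_pos n).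
      rewrite Rmult_assoc, (Rmult_comm _ (exp ((n - d) * s))).
      apply Rmult_le_compat_l; [lra|].
      apply Rle_trans with (exp n * (exp (d * s) * U s)).
      + replace (exp n * (exp (d * s) * U s)) with (exp (d * s) * (exp n * U s)) by ring.
        apply Rmult_le_compat_l; lra.
      + apply Rmult_le_compat_l; lra. }
  assert (Hq1 : 0 <= c1 / (n + b1)) by (apply Rdiv_le_0_compat; lra).
  assert (Hq2 : 0 <= C / (n + sigma)) by (apply Rdiv_le_0_compat; lra).
  assert (HUle : forall t, t <= T -> U t <= U T +
     (c1 / (n + b1) / b1 * exp (b1 * T) + C / (n + sigma) / sigma * exp (sigma * T))).
  { intros t Ht. apply (integrated_upper_bound U P T); try lra.
    - intros s Hs. apply dU; lra.
    - intros s Hs. apply HPle, Hs. }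
  destruct (U_blowup (U T +
     (c1 / (n + b1) / b1 * exp (b1 * T) + C / (n + sigma) / sigma * exp (sigma * T)) + 1))
    as [T2 HT2].
  specialize (HT2 (Rmin T T2) (Rmin_r _ _)). specialize (HUle (Rmin T T2) (Rmin_l _ _)). lra.
Qed.

Lemma singular_near_one (x0 : R) : 0 < x0 < 1 ->
  exists T, T < Ts /\ forall t, t <= T -> x0 <= scaled U t.
Proof.
  intros Hx0.
  pose proof lin_coef_pos as HL. pose proof amplitude_pos as HA.
  pose proof theta_pos as Hth. pose proof friction_pos as Ha.
  destruct singular_scaled_bounded as [X [Tb [HX [HTb Hbd]]]].
  (* [X] puts the ceiling above the a priori bound; [p + 1] ensures [Q M > (p + 1) / 2], hence
     [potential M > 0]. *)
  destruct (Q_onto p p_gt1 (X + p + 1) ltac:(lra)) as [M [HM HQM]].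
  assert (HM1 : 1 < M).
  { apply Rnot_le_lt; intros Hle. pose proof (Q_le p p_gt1 M 1 (conj HM Hle)).
    rewrite Q_1 in H. lra. }
  set (Y := scaled U). set (Z := scaled_slope U P).
  set (T1 := Rmin Tb (Ts - 2)).
  assert (HT1a : T1 <= Tb) by apply Rmin_l. assert (HT1b : T1 <= Ts - 2) by apply Rmin_r.
  assert (HY : forall t, t <= T1 -> 0 < Y t <= M).
  { intros t Ht. assert (HYp : 0 < Y t) by (apply (proj1 (scaled_pos U t)), U_pos; lra).
    split; trivial. apply Rnot_lt_le; intros Hlt.
    pose proof (Q_le p p_gt1 M (Y t) (conj HM (Rlt_le _ _ Hlt))).
    specialize (Hbd t ltac:(lra)). fold Y in Hbd. lra. }
  assert (HZ : forall t, t <= T1 -> Rabs (Z t) <= (theta + exp n) * M).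
  { intros t Ht. specialize (HY t Ht).
    pose proof (singular_slope_nonneg t ltac:(lra)).
    pose proof (singular_slope_le t ltac:(lra)).
    assert (Hq : 0 <= exp (theta * t) * P t / amplitude <= exp n * M).
    { pose proof (exp_pos (theta * t)). pose proof (exp_pos n).
      split; [apply Rdiv_le_0_compat; nra|].
      apply Rle_trans with (exp n * Y t); [|apply Rmult_le_compat_l; lra].
      unfold Y, scaled.
      replace (exp n * (exp (theta * t) * U t / amplitude))
        with (exp (theta * t) * (exp n * U t) / amplitude) by (field; lra).
      apply Rmult_le_compat_r; [left; apply Rinv_0_lt_compat; lra|].
      apply Rmult_le_compat_l; lra. }
    unfold Z, scaled_slope. fold Y.
    assert (0 < theta * Y t <= theta * M) by (split; nra).
    apply Rabs_le. split; nra. }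
  assert (HdY : forall t, t <= T1 -> is_derive Y t (Z t)).
  { intros t Ht. apply is_derive_scaled, dU; lra. }
  set (e := fun t => perturbation (Y t) t).
  assert (HdZ : forall t, t <= T1 ->
    is_derive Z t (- friction * Z t - force lin_coef p (Y t) - e t)).
  { intros t Ht. apply is_derive_scaled_slope; [apply U_pos|apply dU|apply dP]; lra. }
  assert (He : forall eps, 0 < eps -> exists T, forall t, t <= T -> Rabs (e t) <= eps).
  { intros eps Heps. destruct (perturbation_small M eps HM Heps) as [T HT].
    exists (Rmin T T1). intros t Ht. pose proof (Rmin_l T T1). pose proof (Rmin_r T T1).
    apply HT; [lra|apply HY; lra]. }
  destruct singular_not_small as [y1 [Hy1 Hlarge]].
  set (B := lin_coef * (p * Q p M)).
  pose proof (potential_pos lin_coef p HL p_gt1 M HM1 ltac:(lra)) as Hpot.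
  destruct (damping_exists lin_coef p friction HL p_gt1 Ha M B (Rle_refl _) Hpot)
    as [kap [Hk1 [Hk2 [Hk3 [Hk4 [Hk5 Hk6]]]]]].
  destruct (backward_energy_negative lin_coef p friction HL p_gt1 Ha M B HM1 (Rle_refl _)
              kap Hk1 Hk2 Hk3 Hk4 Y Z e T1 _ y1 HdY HdZ He HY HZ Hy1 Hlarge) as [eta [Heta Hneg]].
  destruct (trap lin_coef p friction HL p_gt1 Ha M B HM1 (Rle_refl _)
              kap Hk1 Hk2 Hk3 Hk4 Hk5 Hk6 eta x0 Heta Hx0) as [eps [S [Heps [HS Htrap]]]].
  destruct (He eps Heps) as [T2 HT2].
  exists (Rmin T1 T2).
  pose proof (Rmin_l T1 T2). pose proof (Rmin_r T1 T2). split; [lra|]. intros t Ht.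
  (* Any time of negative energy before [t - S] can serve as start, since [S] does not depend on
     it. *)
  destruct (Hneg (t - S)) as [t0 [Ht0 HV]].
  apply (Htrap Y Z e t0 t); trivial; try lra.
  - intros s Hs. apply HdY; lra.
  - intros s Hs _. apply HdZ; lra.
  - intros s Hs _. apply HT2; lra.
  - apply HY; lra.
Qed.

End Singular.

(** * Regular solutions *)

(** The initial data at [r = 0] become limits at [-oo]: vanishing flux and [U] tending to [zeta].
    The power is [rpow] because a regular solution may leave the positive half line. *)
Definition regular_flow (zeta : R) (U P : R -> R) : Prop :=
  (forall t, is_derive U t (- P t)) /\
  (forall t, is_derive P t (- n * P t + (k t * exp (beta * t) * rpow (U t) p + phi t))) /\
  (forall eps, 0 < eps -> exists T, forall t, t <= T -> Rabs (exp (n * t) * P t) <= eps) /\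
  (forall eps, 0 < eps -> exists T, forall t, t <= T -> Rabs (U t - zeta) <= eps).

Lemma rpow_nonneg (x : R) : 0 <= rpow x p.
Proof. unfold rpow. destruct (Rle_dec x 0); [lra|left; apply exp_pos]. Qed.

Lemma rpow_le (x y : R) : 0 < y -> x <= y -> rpow x p <= Rpower y p.
Proof.
  intros Hy Hxy. unfold rpow. destruct (Rle_dec x 0); [left; apply exp_pos|].
  apply Rle_Rpower_l; lra.
Qed.

Lemma regular_slope_nonneg (zeta : R) (U P : R -> R) (t : R) :
  regular_flow zeta U P -> 0 <= P t.
Proof.
  intros [dU [dP [Pl Ul]]]. apply Rnot_lt_le; intros Hneg.
  pose proof (exp_pos (n * t)) as Hen.
  assert (Hlt : exp (n * t) * P t < 0) by nra.
  destruct (Pl (- (exp (n * t) * P t) / 2) ltac:(lra)) as [T HT].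
  pose proof (Rmin_l T t). pose proof (Rmin_r T t). specialize (HT (Rmin T t) ltac:(lra)).
  assert (Hm : exp (n * Rmin T t) * P (Rmin T t) <= exp (n * t) * P t).
  { apply (increasing_of_derive (fun s => exp (n * s) * P s)
      (fun t => exp (n * t) * (k t * exp (beta * t) * rpow (U t) p + phi t))); trivial.
    - intros v Hv. pose proof (dP v) as H1.
      auto_derive; [eexists; exact H1|]. use_derive H1. ring.
    - intros v Hv. pose proof (rpow_nonneg (U v)). pose proof (k_pos v).
      pose proof (phi_nonneg v). pose proof (exp_pos (n * v)). pose proof (exp_pos (beta * v)).
      assert (0 <= k v * exp (beta * v) * rpow (U v) p) by (repeat apply Rmult_le_pos; lra).
      apply Rmult_le_pos; lra. }
  apply Rabs_le_between in HT. lra.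
Qed.

Lemma regular_le (zeta : R) (U P : R -> R) (t : R) : regular_flow zeta U P -> U t <= zeta.
Proof.
  intros HF. apply Rnot_lt_le; intros Hlt.
  pose proof HF as [dU [dP [Pl Ul]]].
  destruct (Ul ((U t - zeta) / 2) ltac:(lra)) as [T HT].
  pose proof (Rmin_l T t). pose proof (Rmin_r T t). specialize (HT (Rmin T t) ltac:(lra)).
  assert (U t <= U (Rmin T t)).
  { apply (decreasing_of_derive U (fun s => - P s)); trivial.
    intros v _. pose proof (regular_slope_nonneg zeta U P v HF). lra. }
  apply Rabs_le_between in HT. lra.
Qed.

(* In the initial layer the orbit follows the unstable direction [z = theta y] of the origin, along
   which the Lyapunov function is negative because [theta < n / 2]. *)
Lemma regular_initial_layer : exists m eta, 0 < m < 1 /\ 0 < eta /\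
  forall T', exists Z, 0 < Z /\ forall zeta U P, Z < zeta -> regular_flow zeta U P ->
  let t0 := (ln (m * amplitude) - ln zeta) / theta in
  t0 <= T' /\ 0 < scaled U t0 <= m /\
  forall kap, 0 < kap -> lyapunov lin_coef p kap (scaled U t0) (scaled_slope U P t0) <= - eta.
Proof.
  pose proof lin_coef_pos as HL. pose proof amplitude_pos as HA.
  pose proof theta_pos as Hth. pose proof friction_pos as Ha.
  (* Up to [t0], [U] loses at most the fraction [delta] of [zeta]. The second bound keeps the slope
     [z] nonnegative, and with [force <= 0] the cross term of [lyapunov] is then nonpositive for
     every [kap]. *)
  set (delta := Rmin (1 / 2) (theta / (1 + theta))).
  assert (Hd : 0 < delta) by (apply Rmin_glb_lt; [lra|apply Rdiv_lt_0_compat; lra]).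
  assert (Hd1 : delta <= 1 / 2) by apply Rmin_l.
  assert (Hd2 : delta <= theta * (1 - delta)).
  { assert (delta * (1 + theta) <= theta); [|lra].
    replace theta with (theta / (1 + theta) * (1 + theta)) at 2 by (field; lra).
    apply Rmult_le_compat_r; [lra|apply Rmin_r]. }
  (* Three smallness conditions on [Q m]: [q1] yields [P <= delta * zeta] at [t0], [q2] yields
     [U >= (1 - delta) * zeta], and [q3] keeps the superquadratic part of [potential] below
     [theta * friction / 4] times [y ^ 2]. *)
  set (q1 := delta / 2 * ((n + beta) / (2 * lin_coef))).
  set (q2 := delta / 2 * ((n + beta) * beta / (2 * lin_coef))).
  set (q3 := theta * friction / 4 * ((p + 1) / lin_coef)).
  assert (Hq1 : 0 < q1).
  { unfold q1. apply Rmult_lt_0_compat; [lra|apply Rdiv_lt_0_compat; lra]. }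
  assert (Hq2 : 0 < q2).
  { unfold q2. apply Rmult_lt_0_compat; [lra|apply Rdiv_lt_0_compat; [nra|lra]]. }
  assert (Hq3 : 0 < q3).
  { unfold q3. apply Rmult_lt_0_compat; [nra|apply Rdiv_lt_0_compat; lra]. }
  set (q := Rmin (1 / 2) (Rmin q1 (Rmin q2 q3))).
  assert (q <= 1 / 2 /\ q <= q1 /\ q <= q2 /\ q <= q3) as (Hqa & Hqb & Hqc & Hqd).
  { unfold q. pose proof (Rmin_l (1 / 2) (Rmin q1 (Rmin q2 q3))).
    pose proof (Rmin_r (1 / 2) (Rmin q1 (Rmin q2 q3))).
    pose proof (Rmin_l q1 (Rmin q2 q3)). pose proof (Rmin_r q1 (Rmin q2 q3)).
    pose proof (Rmin_l q2 q3). pose proof (Rmin_r q2 q3). lra. }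
  assert (Hq : 0 < q) by (unfold q; repeat apply Rmin_glb_lt; lra).
  destruct (Q_onto p p_gt1 q Hq) as [m [Hm HQm]].
  assert (Hm1 : m < 1).
  { apply Rnot_le_lt; intros Hle. pose proof (Q_le p p_gt1 1 m ltac:(lra)).
    rewrite Q_1 in H. lra. }
  exists m, (m ^ 2 * (theta * friction) / 16).
  split; [lra|]. split.
  { assert (0 < m ^ 2) by (apply pow_lt; lra).
    assert (0 < theta * friction) by nra. nra. }
  intros T'.
  destruct (k_lim k0 k0_pos) as [T1 HT1].
  set (Cs := C / (n + sigma) + C / (n + sigma) / sigma).
  assert (HCs1 : 0 <= C / (n + sigma)) by (apply Rdiv_le_0_compat; lra).
  assert (HCs2 : 0 <= C / (n + sigma) / sigma) by (apply Rdiv_le_0_compat; lra).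
  set (T2 := ln (delta / 2 / (Cs + 1)) / sigma).
  set (T := Rmin T' (Rmin T1 (Rmin T0 T2))).
  assert (T <= T' /\ T <= T1 /\ T <= T0 /\ T <= T2) as (HTa & HTb & HTc & HTd).
  { unfold T. pose proof (Rmin_l T' (Rmin T1 (Rmin T0 T2))).
    pose proof (Rmin_r T' (Rmin T1 (Rmin T0 T2))).
    pose proof (Rmin_l T1 (Rmin T0 T2)). pose proof (Rmin_r T1 (Rmin T0 T2)).
    pose proof (Rmin_l T0 T2). pose proof (Rmin_r T0 T2). lra. }
  (* The exponential gives [t0 <= T]; the [1] gives [zeta > 1], so the contribution of [phi], which
     does not scale with [zeta], is at most [delta / 2 * zeta]. *)
  exists (1 + exp (ln (m * amplitude) - theta * T)).
  pose proof (exp_pos (ln (m * amplitude) - theta * T)).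
  split; [lra|]. intros zeta U P Hz HF t0.
  pose proof HF as [dU [dP [Pl Ul]]].
  assert (HmA : 0 < m * amplitude) by nra.
  assert (Hzp : 0 < zeta) by lra.
  assert (Ht0 : t0 <= T).
  { assert (ln (m * amplitude) - theta * T <= ln zeta).
    { rewrite <- (ln_exp (ln (m * amplitude) - theta * T)). apply ln_le; lra. }
    unfold t0. apply Rmult_le_reg_r with theta; trivial.
    replace ((ln (m * amplitude) - ln zeta) / theta * theta)
      with (ln (m * amplitude) - ln zeta) by (field; lra). lra. }
  split; [lra|].
  (* [t0] is the time at which the constant [zeta] has scaled value [m]. *)
  assert (Hexp : exp (theta * t0) * zeta = m * amplitude).
  { rewrite <- (exp_ln zeta Hzp) at 1. rewrite <- exp_plus.
    rewrite <- (exp_ln (m * amplitude) HmA) at 1. f_equal. unfold t0. field; lra. }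
  assert (Hexpb : k0 * (exp (beta * t0) * Q p zeta) = q * lin_coef).
  { apply (f_equal (Q p)) in Hexp.
    rewrite !Q_mult, Q_exp, Q_amplitude, HQm in Hexp by (trivial; apply exp_pos).
    rewrite Hexp. field; lra. }
  assert (Hsig : Cs * exp (sigma * t0) <= delta / 2).
  { assert (HCp : 0 < delta / 2 / (Cs + 1)) by (apply Rdiv_lt_0_compat; unfold Cs; lra).
    assert (H1 : exp (sigma * t0) <= delta / 2 / (Cs + 1)).
    { rewrite <- (exp_ln _ HCp). apply exp_le_mono.
      replace (ln (delta / 2 / (Cs + 1))) with (sigma * T2) by (unfold T2; field; lra).
      apply Rmult_le_compat_l; lra. }
    pose proof (exp_pos (sigma * t0)).
    replace (delta / 2) with ((Cs + 1) * (delta / 2 / (Cs + 1))) by (field; unfold Cs; lra).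
    apply Rmult_le_compat; unfold Cs in *; lra. }
  set (c1 := 2 * k0 * Rpower zeta p).
  assert (Hc1 : 0 < c1) by (unfold c1; assert (0 < Rpower zeta p) by apply exp_pos; nra).
  assert (Hc1e : c1 * exp (beta * t0) = 2 * lin_coef * q * zeta).
  { unfold c1. rewrite Rpower_Q by trivial.
    replace (2 * k0 * (zeta * Q p zeta) * exp (beta * t0))
      with (2 * zeta * (k0 * (exp (beta * t0) * Q p zeta))) by ring.
    rewrite Hexpb. ring. }
  assert (HPle : forall t, t <= T -> P t <=
     c1 / (n + beta) * exp (beta * t) + C / (n + sigma) * exp (sigma * t)).
  { apply (linear_upper_bound P (fun t => k t * exp (beta * t) * rpow (U t) p + phi t)); try lra.
    - intros t _; apply dP.
    - intros t Ht. apply Rplus_le_compat; [|apply phi_le; lra].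
      pose proof (rpow_le (U t) zeta Hzp (regular_le zeta U P t HF)).
      pose proof (rpow_nonneg (U t)). specialize (HT1 t ltac:(lra)).
      apply Rabs_le_between in HT1. pose proof (k_pos t). pose proof (exp_pos (beta * t)).
      unfold c1. replace (2 * k0 * Rpower zeta p * exp (beta * t))
        with (2 * k0 * exp (beta * t) * Rpower zeta p) by ring.
      apply Rmult_le_compat; nra.
    - intros e T3 He. destruct (Pl e He) as [T4 HT4].
      exists (Rmin T3 T4). split; [apply Rmin_l|].
      specialize (HT4 (Rmin T3 T4) (Rmin_r _ _)). apply Rabs_le_between in HT4. lra. }
  assert (Hc1n : 0 < c1 / (n + beta)) by (apply Rdiv_lt_0_compat; lra).
  assert (HP0 : P t0 <= delta * zeta).
  { eapply Rle_trans; [apply HPle, Ht0|].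
    assert (E1 : c1 / (n + beta) * exp (beta * t0) <= delta / 2 * zeta).
    { replace (c1 / (n + beta) * exp (beta * t0)) with (c1 * exp (beta * t0) / (n + beta))
        by (field; lra). rewrite Hc1e.
      replace (delta / 2 * zeta) with (2 * lin_coef * q1 * zeta / (n + beta))
        by (unfold q1; field; lra).
      apply Rmult_le_compat_r; [left; apply Rinv_0_lt_compat; lra|].
      apply Rmult_le_compat_r; [lra|]. apply Rmult_le_compat_l; lra. }
    assert (E2 : C / (n + sigma) * exp (sigma * t0) <= delta / 2).
    { eapply Rle_trans; [|exact Hsig]. apply Rmult_le_compat_r; [left; apply exp_pos|].
      unfold Cs; lra. }
    nra. }
  assert (HU0 : zeta * (1 - delta) <= U t0).
  { apply Rnot_lt_le; intros Hlt.
    destruct (Ul ((zeta * (1 - delta) - U t0) / 2) ltac:(lra)) as [T3 HT3].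
    pose proof (Rmin_l T3 t0). pose proof (Rmin_r T3 t0).
    specialize (HT3 (Rmin T3 t0) ltac:(lra)). apply Rabs_le_between in HT3.
    pose proof (integrated_upper_bound U P T (c1 / (n + beta)) beta (C / (n + sigma)) sigma
      ltac:(lra) ltac:(lra) ltac:(lra) ltac:(lra) (fun t _ => dU t) HPle (Rmin T3 t0) t0
      ltac:(lra) Ht0) as HI.
    assert (E1 : c1 / (n + beta) / beta * exp (beta * t0) <= delta / 2 * zeta).
    { replace (c1 / (n + beta) / beta * exp (beta * t0))
        with (c1 * exp (beta * t0) / ((n + beta) * beta)) by (field; lra). rewrite Hc1e.
      replace (delta / 2 * zeta) with (2 * lin_coef * q2 * zeta / ((n + beta) * beta))
        by (unfold q2; field; lra).
      apply Rmult_le_compat_r; [left; apply Rinv_0_lt_compat; nra|].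
      apply Rmult_le_compat_r; [lra|]. apply Rmult_le_compat_l; lra. }
    assert (E2 : C / (n + sigma) / sigma * exp (sigma * t0) <= delta / 2).
    { eapply Rle_trans; [|exact Hsig]. apply Rmult_le_compat_r; [left; apply exp_pos|].
      unfold Cs; lra. }
    nra. }
  pose proof (regular_slope_nonneg zeta U P t0 HF) as HPn.
  pose proof (regular_le zeta U P t0 HF) as HUn.
  assert (Hsc : forall x, exp (theta * t0) * x / amplitude = m * (x / zeta)).
  { intros x. replace (exp (theta * t0) * x / amplitude)
      with (exp (theta * t0) * zeta * (x / zeta) / amplitude) by (field; lra).
    rewrite Hexp. field; lra. }
  assert (Hy0 : m * (1 - delta) <= scaled U t0 <= m).
  { unfold scaled. rewrite Hsc. split.
    - apply Rmult_le_compat_l; [lra|]. apply Rmult_le_reg_r with zeta; trivial.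
      replace (U t0 / zeta * zeta) with (U t0) by (field; lra). lra.
    - replace m with (m * 1) at 2 by ring. apply Rmult_le_compat_l; [lra|].
      apply Rmult_le_reg_r with zeta; trivial.
      replace (U t0 / zeta * zeta) with (U t0) by (field; lra). lra. }
  assert (Hyp : 0 < scaled U t0) by nra.
  assert (Hz0 : 0 <= scaled_slope U P t0 <= theta * scaled U t0).
  { unfold scaled_slope. rewrite Hsc.
    assert (Hr : 0 <= P t0 / zeta <= delta).
    { split; [apply Rdiv_le_0_compat; lra|]. apply Rmult_le_reg_r with zeta; trivial.
      replace (P t0 / zeta * zeta) with (P t0) by (field; lra). lra. }
    assert (m * (P t0 / zeta) <= m * (theta * (1 - delta))) by (apply Rmult_le_compat_l; lra).
    assert (theta * (m * (1 - delta)) <= theta * scaled U t0) by (apply Rmult_le_compat_l; lra).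
    assert (0 <= m * (P t0 / zeta)) by (apply Rmult_le_pos; lra).
    split; lra. }
  split; [lra|]. intros kap Hkap.
  set (y0 := scaled U t0) in *. set (z0 := scaled_slope U P t0) in *.
  unfold lyapunov.
  pose proof (force_nonpos lin_coef p HL p_gt1 y0 ltac:(lra)) as Hf.
  assert (Hkzf : kap * (z0 * force lin_coef p y0) <= 0).
  { assert (0 <= kap * z0) by (apply Rmult_le_pos; lra). nra. }
  assert (Hz2 : z0 ^ 2 <= theta ^ 2 * y0 ^ 2).
  { rewrite <- Rpow_mult_distr. apply pow_incr; lra. }
  assert (Hpot : potential lin_coef p y0 <= y0 ^ 2 * (theta * friction / 4 - lin_coef / 2)).
  { unfold potential. pose proof (Q_le p p_gt1 y0 m ltac:(lra)) as HQ.
    assert (Hd4 : lin_coef * (Q p y0 / (p + 1)) <= theta * friction / 4).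
    { replace (theta * friction / 4) with (lin_coef * (q3 / (p + 1)))
        by (unfold q3; field; lra).
      apply Rmult_le_compat_l; [lra|]. apply Rmult_le_compat_r; [|lra].
      left; apply Rinv_0_lt_compat; lra. }
    replace (lin_coef * y0 ^ 2 * (Q p y0 / (p + 1) - 1 / 2))
      with (y0 ^ 2 * (lin_coef * (Q p y0 / (p + 1)) - lin_coef / 2)) by (field; lra).
    apply Rmult_le_compat_l; [apply pow2_ge_0|lra]. }
  assert (HLf : lin_coef - theta ^ 2 = theta * friction) by (unfold lin_coef, friction; ring).
  assert (Hy2 : m ^ 2 / 4 <= y0 ^ 2).
  { replace (m ^ 2 / 4) with ((m / 2) ^ 2) by field. apply pow_incr.
    assert (m * (1 / 2) <= m * (1 - delta)) by (apply Rmult_le_compat_l; lra). lra. }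
  assert (Htf : 0 < theta * friction) by (apply Rmult_lt_0_compat; lra).
  assert (Hmul : m ^ 2 / 4 * (theta * friction / 4) <= y0 ^ 2 * (theta * friction / 4))
    by (apply Rmult_le_compat_r; lra).
  replace (lin_coef) with (theta * friction + theta ^ 2) in Hpot at 2 by lra.
  lra.
Qed.

(** The right end [T] comes only from the size of the perturbation and is fixed before [T']: raising
    [zeta] extends the interval to the left. *)
Lemma regular_near_one (x0 : R) : 0 < x0 < 1 ->
  exists T, forall T', exists Z, 0 < Z /\ forall zeta U P, Z < zeta -> regular_flow zeta U P ->
  forall t, T' <= t <= T -> x0 <= scaled U t.
Proof.
  intros Hx0.
  pose proof lin_coef_pos as HL. pose proof friction_pos as Ha.
  destruct regular_initial_layer as [m [eta [Hm [Heta Hlayer]]]].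
  destruct (Q_onto p p_gt1 (p + 1) ltac:(lra)) as [M [HM HQM]].
  assert (HM1 : 1 < M).
  { apply Rnot_le_lt; intros Hle. pose proof (Q_le p p_gt1 M 1 (conj HM Hle)).
    rewrite Q_1 in H. lra. }
  set (B := lin_coef * (p * Q p M)).
  pose proof (potential_pos lin_coef p HL p_gt1 M HM1 ltac:(lra)) as Hpot.
  destruct (damping_exists lin_coef p friction HL p_gt1 Ha M B (Rle_refl _) Hpot)
    as [kap [Hk1 [Hk2 [Hk3 [Hk4 [Hk5 Hk6]]]]]].
  destruct (trap lin_coef p friction HL p_gt1 Ha M B HM1 (Rle_refl _)
              kap Hk1 Hk2 Hk3 Hk4 Hk5 Hk6 eta x0 Heta Hx0) as [eps [S [Heps [HS Htrap]]]].
  destruct (perturbation_small M eps HM Heps) as [T HT].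
  exists T. intros T'.
  (* The layer must end [S] before [T'] to leave the waiting time of [trap]. *)
  destruct (Hlayer (T' - S)) as [Z [HZ Hz]].
  exists Z; split; trivial. intros zeta U P Hzeta HF t Ht.
  destruct (Hz zeta U P Hzeta HF) as [Ht0 [Hy0 HV]].
  set (t0 := (ln (m * amplitude) - ln zeta) / theta) in *.
  destruct HF as [dU [dP _]].
  apply (Htrap (scaled U) (scaled_slope U P) (fun t => perturbation (scaled U t) t) t0 T);
    try lra.
  - intros s _. apply is_derive_scaled, dU.
  - intros s _ Hs. apply (proj2 (scaled_pos U s)) in Hs. apply is_derive_scaled_slope; trivial.
    specialize (dP s). unfold rpow in dP. destruct (Rle_dec (U s) 0); [lra|trivial].
  - intros s Hs Hys. apply HT; lra.
  - apply HV; lra.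
Qed.

(** * Intersections *)

(** The inequality holds strictly at [x0 = 1], and [r] is the value of [x0 ^ p] that gives equality
    with [omega = 0]. The midpoint of [r] and [1] leaves the surplus [w] for [omega ^ 2]. *)
Lemma threshold_exists : friction ^ 2 / 4 < (p - 1) * lin_coef ->
  exists x0 omega, 0 < x0 < 1 /\ 0 < omega /\
  omega ^ 2 + friction ^ 2 / 4 <= lin_coef * (p * (x0 * Q p x0)) - lin_coef.
Proof.
  intros Hosc. pose proof lin_coef_pos as HL. pose proof (pow2_ge_0 friction).
  set (r := (lin_coef + friction ^ 2 / 4) / (p * lin_coef)).
  assert (HpL : 0 < p * lin_coef) by (apply Rmult_lt_0_compat; lra).
  assert (Hr : 0 < r < 1).
  { split; [apply Rdiv_lt_0_compat; lra|].
    apply Rmult_lt_reg_r with (p * lin_coef); trivial.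
    unfold r. field_simplify; lra. }
  set (x0 := Rpower ((1 + r) / 2) (/ p)).
  assert (Hx0 : x0 * Q p x0 = (1 + r) / 2).
  { rewrite <- Rpower_Q by apply exp_pos. unfold x0.
    rewrite Rpower_mult, Rinv_l by lra. apply Rpower_1; lra. }
  set (w := p * lin_coef * ((1 - r) / 2)).
  assert (Hw : 0 < w) by (unfold w; apply Rmult_lt_0_compat; lra).
  exists x0, (sqrt w). split; [split; [apply exp_pos|]|split; [now apply sqrt_lt_R0|]].
  - apply Rnot_le_lt; intros Hle. pose proof (Q_le p p_gt1 1 x0 ltac:(lra)) as HQ.
    rewrite Q_1 in HQ. nra.
  - rewrite Hx0, pow2_sqrt by lra. right. unfold w, r. field. lra.
Qed.

Lemma many_intersections (U0 P0 : R -> R) (Ts : R) (M : nat) :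
  friction ^ 2 / 4 < (p - 1) * lin_coef ->
  (forall t, t < Ts -> 0 < U0 t) ->
  (forall t, t < Ts -> is_derive U0 t (- P0 t)) ->
  (forall t, t < Ts ->
    is_derive P0 t (- n * P0 t + (k t * exp (beta * t) * Rpower (U0 t) p + phi t))) ->
  (forall X, exists T, forall t, t <= T -> X <= U0 t) ->
  exists Z, 0 < Z /\ forall zeta U P, Z < zeta -> regular_flow zeta U P ->
  exists tt : nat -> R, (forall i, (i < M)%nat -> tt i < Ts /\ U (tt i) = U0 (tt i)) /\
    (forall i, (S i < M)%nat -> tt i < tt (S i)).
Proof.
  intros Hosc U0_pos dU0 dP0 blowup.
  pose proof lin_coef_pos as HL. pose proof amplitude_pos as HA.
  destruct (threshold_exists Hosc) as [x0 [omega [Hx0 [Hom Hineq]]]].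
  destruct (singular_near_one U0 P0 Ts U0_pos dU0 dP0 blowup x0 Hx0) as [T1 [HT1s HT1]].
  destruct (regular_near_one x0 Hx0) as [T2 HT2].
  destruct (k_lim (k0 * (1 - x0))) as [T3 HT3]; [apply Rmult_lt_0_compat; lra|].
  set (T := Rmin T1 (Rmin T2 T3)).
  assert (T <= T1 /\ T <= T2 /\ T <= T3) as (HTa & HTb & HTc).
  { unfold T. pose proof (Rmin_l T1 (Rmin T2 T3)). pose proof (Rmin_r T1 (Rmin T2 T3)).
    pose proof (Rmin_l T2 T3). pose proof (Rmin_r T2 T3). lra. }
  set (l := PI / omega).
  assert (Hl : 0 < l) by (apply Rdiv_lt_0_compat; [apply PI_RGT_0|trivial]).
  (* The [M] windows of length [l] start [2 l] apart, so they are disjoint and the zeros found in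
     them come ordered. *)
  destruct (HT2 (T - 2 * INR M * l)) as [Z [HZ Hreg]].
  exists Z; split; trivial. intros zeta U P Hzeta HF.
  specialize (Hreg zeta U P Hzeta HF). destruct HF as [dU [dP _]].
  assert (Hz : forall i, (i < M)%nat -> exists t,
     T - 2 * (INR M - INR i) * l <= t <= T - 2 * (INR M - INR i) * l + l /\ U t = U0 t).
  { intros i Hi. apply lt_INR in Hi. set (s := T - 2 * (INR M - INR i) * l).
    assert (Hi1 : 1 <= INR M - INR i).
    { apply INR_lt in Hi. rewrite <- minus_INR by lia. apply (le_INR 1). lia. }
    pose proof (pos_INR i) as Hi0.
    assert (HsT : s + l <= T) by (unfold s; nra).
    assert (HsM : T - 2 * INR M * l <= s) by (unfold s; nra).
    assert (Hlow : forall t, s <= t <= s + l ->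
       x0 <= scaled U t /\ x0 <= scaled U0 t /\ x0 <= k t / k0).
    { intros t Ht. split; [apply Hreg; lra|]. split; [apply HT1; lra|].
      specialize (HT3 t ltac:(lra)). apply Rabs_le_between in HT3.
      apply Rmult_le_reg_r with k0; trivial.
      replace (k t / k0 * k0) with (k t) by (field; lra). lra. }
    destruct (common_value lin_coef p friction omega x0 (fun t => k t / k0)
       (fun t => exp (theta * t) * phi t / amplitude) HL p_gt1 Hom (proj1 Hx0) Hineq
       (scaled U) (scaled_slope U P) (scaled U0) (scaled_slope U0 P0) s) as [t [Ht Heq]].
    - fold l. intros t Ht. destruct (Hlow t Ht) as [HUt _]. split; split.
      + apply is_derive_scaled, dU.
      + assert (HUp : 0 < U t) by (apply (proj2 (scaled_pos U t)); lra).
        apply is_derive_scaled_slope; trivial.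
        specialize (dP t). unfold rpow in dP. destruct (Rle_dec (U t) 0); [lra|trivial].
      + apply is_derive_scaled, dU0; lra.
      + apply is_derive_scaled_slope; [apply U0_pos|apply dU0|apply dP0]; lra.
    - exact Hlow.
    - exists t; split; trivial. unfold scaled in Heq.
      pose proof (exp_pos (theta * t)).
      apply Rmult_eq_reg_l with (exp (theta * t) / amplitude).
      + unfold Rdiv in *. lra.
      + apply Rgt_not_eq, Rdiv_lt_0_compat; lra. }
  (* Indices from [M] on get the dummy value [0], so that choice yields a function on all of
     [nat]. *)
  assert (Hch : forall i, exists t, (i < M)%nat ->
     T - 2 * (INR M - INR i) * l <= t <= T - 2 * (INR M - INR i) * l + l /\ U t = U0 t).
  { intros i. destruct (Compare_dec.lt_dec i M) as [Hi|Hi].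
    - destruct (Hz i Hi) as [t Ht]. now exists t.
    - exists 0. intros; lia. }
  set (tt := fun i => proj1_sig (constructive_indefinite_description _ (Hch i))).
  assert (Htt : forall i, (i < M)%nat ->
     T - 2 * (INR M - INR i) * l <= tt i <= T - 2 * (INR M - INR i) * l + l /\
     U (tt i) = U0 (tt i)).
  { intros i. exact (proj2_sig (constructive_indefinite_description _ (Hch i))). }
  exists tt. split.
  - intros i Hi. destruct (Htt i Hi) as [Ht1 Ht2]. split; trivial.
    assert (1 <= INR M - INR i) by (rewrite <- minus_INR by lia; apply (le_INR 1); lia). nra.
  - intros i Hi. destruct (Htt i ltac:(lia)) as [Ht1 _]. destruct (Htt (S i) Hi) as [Ht2 _].
    rewrite S_INR in Ht2. lra.
Qed.

End Radial.

(* [p < p_JL] says that [2 theta] exceeds the smaller root of a quadratic, and [2 theta < n] puts it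
   below the larger one. *)
Lemma joseph_lundgren (n beta p : R) : 0 < n -> 0 < beta -> 1 < p -> 2 * theta beta p < n ->
  (4 * beta < n -> (p - 1) * (n - beta - sqrt (beta * (2 * n + beta))) < 2 * beta) ->
  friction n beta p ^ 2 / 4 < (p - 1) * lin_coef n beta p.
Proof.
  intros Hn Hb Hp Hs HJL. unfold friction, lin_coef.
  set (x := theta beta p) in *. set (D := sqrt (beta * (2 * n + beta))) in *.
  assert (Hx : (p - 1) * x = beta) by (unfold x, theta; field; lra).
  assert (Hx0 : 0 < x) by (apply Rdiv_lt_0_compat; lra).
  assert (HD2 : D * D = beta * (2 * n + beta)) by (apply sqrt_sqrt; nra).
  assert (HD0 : 0 <= D) by apply sqrt_pos.
  assert (HDb : beta <= D) by nra.
  assert (Hlow : n - beta - D < 2 * x).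
  { destruct (Rlt_dec (4 * beta) n) as [Hlt|Hge].
    - specialize (HJL Hlt). apply Rmult_lt_reg_l with (p - 1); [lra|]. nra.
    (* For [n <= 4 beta] the smaller root is nonpositive, since
       [(n - beta) ^ 2 - D ^ 2 = n (n - 4 beta)]. *)
    - enough (n - beta <= D) by lra. destruct (Rle_dec n beta); nra. }
  replace ((p - 1) * (x * (n - x))) with ((p - 1) * x * (n - x)) by ring. rewrite Hx.
  (* Expanded, this product says [(n - 2 x) ^ 2 < 4 beta (n - x)], which is the goal. *)
  assert (0 < (D - (2 * x - n + beta)) * (D + (2 * x - n + beta)))
    by (apply Rmult_lt_0_compat; lra).
  nra.
Qed.

(** * From the integral equation to logarithmic time *)

Lemma filterlim_linear (f g : R -> R) (a b x y z : R) (F : (R -> Prop) -> Prop) {FF : Filter F} :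
  filterlim f F (locally a) -> filterlim g F (locally b) ->
  filterlim (fun e => x * f e + y * g e + z) F (locally (x * a + y * b + z)).
Proof.
  intros Hf Hg.
  assert (Hscal : forall (h : R -> R) (c l : R), filterlim h F (locally l) ->
    filterlim (fun e => c * h e) F (locally (c * l))).
  { intros h c l Hh. apply (filterlim_comp _ _ _ h (fun v => c * v) F (locally l)); trivial.
    apply (filterlim_scal_r (K := R_AbsRing) (V := R_NormedModule) c l). }
  assert (Hplus : forall (h1 h2 : R -> R) (l1 l2 : R), filterlim h1 F (locally l1) ->
    filterlim h2 F (locally l2) -> filterlim (fun e => h1 e + h2 e) F (locally (l1 + l2))).
  { intros h1 h2 l1 l2 H1 H2. eapply filterlim_comp_2; [exact H1|exact H2|].
    apply (filterlim_plus (K := R_AbsRing) (V := R_NormedModule)). }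
  apply Hplus; [|apply filterlim_const]. now apply Hplus; apply Hscal.
Qed.

Lemma at_right_exp (A : R -> Prop) : at_right 0 A -> exists T, forall t, t <= T -> A (exp t).
Proof.
  intros [d Hd]. pose proof (cond_pos d). exists (ln (d / 2)). intros t Ht.
  pose proof (exp_pos t). apply Hd; trivial.
  apply exp_le_mono in Ht. rewrite exp_ln in Ht by lra.
  change (Rabs (exp t - 0) < d). rewrite Rminus_0_r, Rabs_right; lra.
Qed.

Lemma filterlim_exp (g : R -> R) (l eps : R) :
  filterlim g (at_right 0) (locally l) -> 0 < eps ->
  exists T, forall t, t <= T -> Rabs (g (exp t) - l) <= eps.
Proof.
  intros Hg He.
  destruct (at_right_exp (fun r => ball l (mkposreal eps He) (g r))) as [T HT].
  - apply Hg, locally_ball.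
  - exists T. intros t Ht. left. apply (HT t Ht).
Qed.

Lemma exp_pow_INR (t : R) (m : nat) : exp t ^ m = exp (INR m * t).
Proof.
  rewrite <- Rpower_pow by apply exp_pos. unfold Rpower. now rewrite ln_exp.
Qed.

Lemma rpow_Rmax (x p : R) : rpow (Rmax x 0) p = rpow x p.
Proof.
  unfold rpow. destruct (Rle_dec x 0) as [Hx|Hx].
  - rewrite Rmax_right by trivial. destruct (Rle_dec 0 0); [trivial|lra].
  - rewrite Rmax_left by lra. destruct (Rle_dec x 0); [lra|trivial].
Qed.

Lemma continuous_rpow (p x : R) : 0 < p -> continuous (fun y => rpow y p) x.
Proof.
  intros Hp. destruct (Rtotal_order x 0) as [Hx|[Hx|Hx]].
  - apply (continuous_ext_loc _ (fun _ => 0)); [|apply continuous_const].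
    exists (mkposreal (- x) ltac:(lra)). intros y Hy. simpl in Hy.
    apply Rabs_def2 in Hy. unfold minus, plus, opp in Hy; simpl in Hy.
    unfold rpow. destruct (Rle_dec y 0); [trivial|lra].
  - subst x. intros A [eps HA]. pose proof (cond_pos eps) as Heps.
    (* The radius is the [p]-th root of [eps / 2]. *)
    assert (Hd : 0 < Rpower (eps / 2) (/ p)) by apply exp_pos.
    exists (mkposreal _ Hd). intros y Hy. apply HA. simpl in Hy.
    apply Rabs_def2 in Hy. unfold minus, plus, opp in Hy; simpl in Hy.
    change (Rabs (rpow y p - rpow 0 p) < eps).
    unfold rpow at 2. destruct (Rle_dec 0 0); [|lra].
    unfold rpow. destruct (Rle_dec y 0); [rewrite Rminus_0_r, Rabs_R0; trivial|].
    assert (H0 : 0 < Rpower y p) by apply exp_pos.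
    rewrite Rminus_0_r, Rabs_right by lra.
    apply Rle_lt_trans with (eps / 2); [|lra].
    rewrite <- (Rpower_1 (eps / 2)) by lra.
    replace 1 with (/ p * p) by (field; lra). rewrite <- Rpower_mult.
    apply Rle_Rpower_l; lra.
  - apply (continuous_ext_loc _ (fun y => Rpower y p)).
    + exists (mkposreal x Hx). intros y Hy. simpl in Hy.
      apply Rabs_def2 in Hy. unfold minus, plus, opp in Hy; simpl in Hy.
      unfold rpow. destruct (Rle_dec y 0); [lra|trivial].
    + apply (ex_derive_continuous (fun y => Rpower y p)).
      unfold Rpower. auto_derive; trivial.
Qed.

Lemma ex_RInt_positive (h : R -> R) (x y : R) :
  (forall r, 0 < r -> continuous h r) -> 0 < x -> 0 < y -> ex_RInt h x y.
Proof.
  intros Hh Hx Hy. apply (ex_RInt_continuous (V := R_CompleteNormedModule)).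
  intros z [Hz _]. apply Hh. eapply Rlt_le_trans; [|exact Hz]. now apply Rmin_glb_lt.
Qed.

(** The base point is [1] because integrals from [0] are only improper. *)
Lemma is_derive_RInt_positive (h : R -> R) (r : R) :
  (forall r, 0 < r -> continuous h r) -> 0 < r -> is_derive (fun x => RInt h 1 x) r (h r).
Proof.
  intros Hh Hr. apply (is_derive_RInt (V := R_NormedModule) h (fun x => RInt h 1 x) 1).
  - exists (mkposreal r Hr). intros x Hx. simpl in Hx.
    apply Rabs_def2 in Hx. unfold minus, plus, opp in Hx; simpl in Hx.
    apply (RInt_correct (V := R_CompleteNormedModule)), ex_RInt_positive; trivial; lra.
  - now apply Hh.
Qed.

Lemma is_derive_RInt_exp (h : R -> R) (t : R) : (forall r, 0 < r -> continuous h r) ->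
  is_derive (fun s => RInt h 1 (exp s)) t (exp t * h (exp t)).
Proof.
  intros Hh. apply (is_derive_comp (fun x => RInt h 1 x) exp).
  - apply is_derive_RInt_positive; [trivial|apply exp_pos].
  - auto_derive; trivial; ring.
Qed.

Section Reduction.

Variables (N : nat) (K f : R -> R) (mu p zeta : R) (u : R -> R).
Hypotheses (N_ge3 : (3 <= N)%nat) (p_pos : 0 < p)
  (K_cont : forall r, 0 < r -> continuous K r)
  (f_cont : forall r, 0 < r -> continuous f r)
  (u_reg : regular_solution N K f mu p zeta u).

Definition source (s : R) : R := K s * rpow (Rmax (u s) 0) p + mu * f s.

Lemma continuous_source (r : R) : 0 < r -> continuous source r.
Proof.
  intros Hr. destruct u_reg as [_ [_ [Hu _]]].
  apply (continuous_ext (fun s => K s * rpow (u s) p + mu * f s)).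
  { intros s. unfold source. now rewrite rpow_Rmax. }
  apply (continuous_plus (fun s => K s * rpow (u s) p) (fun s => mu * f s)).
  - apply (continuous_mult K (fun s => rpow (u s) p)); [now apply K_cont|].
    apply (continuous_comp u (fun y => rpow y p)); [now apply Hu|now apply continuous_rpow].
  - apply (continuous_scal_r mu f). now apply f_cont.
Qed.

(** The kernel times [s ^ (N - 1)] is a multiple of [s - r ^ (2 - N) s ^ (N - 1)], so only the
    moments of order [1] and [N - 1] occur. *)
Definition moment (j : nat) (s : R) : R := s ^ j * source s.

Lemma continuous_moment (j : nat) (r : R) : 0 < r -> continuous (moment j) r.
Proof.
  intros Hr. apply (continuous_mult (fun s => s ^ j) source).
  - apply (ex_derive_continuous (fun s => s ^ j)). auto_derive; trivial.
  - now apply continuous_source.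
Qed.

Lemma kernel_split (e r : R) : 0 < e -> 0 < r ->
  RInt (kern_integrand N K f mu p u r) e r =
  (RInt (moment 1) e 1 + RInt (moment 1) 1 r
   - / r ^ (N - 2) * (RInt (moment (N - 1)) e 1 + RInt (moment (N - 1)) 1 r)) / (INR N - 2).
Proof.
  intros He Hr.
  assert (Hn : INR N - 2 <> 0).
  { apply (le_INR 3) in N_ge3. simpl in N_ge3. lra. }
  assert (Hex : forall j x y, 0 < x -> 0 < y -> ex_RInt (moment j) x y).
  { intros j x y Hx Hy. apply ex_RInt_positive; trivial. apply continuous_moment. }
  assert (HC : forall j, RInt (moment j) e 1 + RInt (moment j) 1 r = RInt (moment j) e r).
  { intros j. apply (RInt_Chasles (V := R_CompleteNormedModule)); apply Hex; lra. }
  rewrite !HC.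
  rewrite (RInt_ext _ (fun s => scal (/ (INR N - 2))
      (minus (moment 1 s) (scal (/ r ^ (N - 2)) (moment (N - 1) s))))).
  - rewrite (RInt_scal (V := R_CompleteNormedModule)).
    + rewrite (RInt_minus (V := R_CompleteNormedModule)).
      * rewrite (RInt_scal (V := R_CompleteNormedModule)) by (apply Hex; lra).
        unfold scal, minus, plus, opp; simpl; unfold mult; simpl. field.
        split; [apply pow_nonzero; lra|trivial].
      * apply Hex; lra.
      * apply (ex_RInt_scal (V := R_CompleteNormedModule)), Hex; lra.
    + apply (ex_RInt_minus (V := R_CompleteNormedModule)); [apply Hex; lra|].
      apply (ex_RInt_scal (V := R_CompleteNormedModule)), Hex; lra.
  - intros s [Hs _]. assert (Hs0 : 0 < s).
    { eapply Rlt_trans; [|exact Hs]. now apply Rmin_glb_lt. }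
    unfold kern_integrand, moment, source.
    unfold scal, minus, plus, opp; simpl; unfold mult; simpl.
    replace (N - 1)%nat with (S (N - 2)) by lia. simpl.
    field. repeat split; try apply pow_nonzero; lra.
Qed.

(* The integral equation at [r = 1] and [r = 2] forces both moments to converge at [0]. *)
Lemma moments_converge : exists A0 B0,
  filterlim (fun e => RInt (moment (N - 1)) e 1) (at_right 0) (locally B0) /\
  forall r, 0 < r -> u r = zeta - (A0 + RInt (moment 1) 1 r
     - / r ^ (N - 2) * (B0 + RInt (moment (N - 1)) 1 r)) / (INR N - 2).
Proof.
  destruct u_reg as [_ [_ [_ Hint]]].
  assert (Hn : 0 < INR N - 2).
  { apply (le_INR 3) in N_ge3. simpl in N_ge3. lra. }
  set (n := INR N - 2) in *.
  set (Af := fun e => RInt (moment 1) e 1). set (Bf := fun e => RInt (moment (N - 1)) e 1).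
  set (Ia := fun r => RInt (moment 1) 1 r). set (Ib := fun r => RInt (moment (N - 1)) 1 r).
  set (c := fun r => / r ^ (N - 2)).
  assert (HF : forall r, 0 < r -> filterlim (fun e =>
      (Af e + Ia r - c r * (Bf e + Ib r)) / n) (at_right 0) (locally (zeta - u r))).
  { intros r Hr. apply (filterlim_ext_loc (fun e => RInt (kern_integrand N K f mu p u r) e r)).
    - exists (mkposreal 1 Rlt_0_1). intros e _ He. now apply kernel_split.
    - now apply Hint. }
  assert (Hc1 : c 1 = 1) by (unfold c; rewrite pow1; field).
  assert (Hc2 : 0 < c 2 < 1).
  { unfold c. split; [apply Rinv_0_lt_compat, pow_lt; lra|].
    rewrite <- Rinv_1. apply Rinv_lt_contravar; [rewrite Rmult_1_l; apply pow_lt; lra|].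
    apply Rlt_pow_R1; [lra|lia]. }
  pose proof (HF 1 Rlt_0_1) as H1. pose proof (HF 2 Rlt_0_2) as H2. rewrite Hc1 in H1.
  (* Solution of a linear system in the two limits; it is invertible because [c 2] differs from
     [c 1 = 1]. *)
  set (z := (Ia 1 - Ib 1 - (Ia 2 - c 2 * Ib 2)) / (1 - c 2)).
  set (B0 := n / (1 - c 2) * (zeta - u 2) + - (n / (1 - c 2)) * (zeta - u 1) + z).
  assert (HB : filterlim Bf (at_right 0) (locally B0)).
  { eapply filterlim_ext; [|apply (filterlim_linear _ _ _ _ (n / (1 - c 2)) (- (n / (1 - c 2))) z _ H2 H1)].
    intros e. simpl. unfold z. field. split; lra. }
  set (A0 := n * (zeta - u 1) + 1 * B0 + (Ib 1 - Ia 1)).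
  assert (HA : filterlim Af (at_right 0) (locally A0)).
  { eapply filterlim_ext; [|apply (filterlim_linear _ _ _ _ n 1 (Ib 1 - Ia 1) _ H1 HB)].
    intros e. simpl. field. lra. }
  exists A0, B0. split; trivial. intros r Hr.
  assert (HL : filterlim (fun e => (Af e + Ia r - c r * (Bf e + Ib r)) / n) (at_right 0)
     (locally (/ n * A0 + - (c r / n) * B0 + (Ia r - c r * Ib r) / n))).
  { eapply filterlim_ext; [|apply (filterlim_linear _ _ _ _ (/ n) (- (c r / n))
                              ((Ia r - c r * Ib r) / n) _ HA HB)].
    intros e. simpl. field. lra. }
  pose proof (filterlim_locally_unique _ _ _ (HF r Hr) HL) as Heq.
  fold (Ia r) (Ib r) (c r).
  replace ((A0 + Ia r - c r * (B0 + Ib r)) / n)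
    with (/ n * A0 + - (c r / n) * B0 + (Ia r - c r * Ib r) / n) by (field; lra).
  rewrite <- Heq. ring.
Qed.

(** Once the improper integral is replaced by [A0], [B0] and proper integrals from [1], the formula
    for [u] can be differentiated. The contributions of the varying kernel cancel, which leaves
    [P = - r u'] as a single moment. *)
Lemma regular_solution_flow (alpha : R) : exists P,
  regular_flow (INR N - 2) (2 + alpha) p (fun t => K (exp t) * exp (- alpha * t))
    (fun t => mu * exp (2 * t) * f (exp t)) zeta (fun t => u (exp t)) P.
Proof.
  destruct moments_converge as [A0 [B0 [HB Hu]]].
  pose proof N_ge3 as HN. apply (le_INR 3) in HN. simpl in HN.
  assert (HN2 : INR (N - 2) = INR N - 2) by (rewrite minus_INR by lia; simpl; ring).
  assert (HN1 : INR (N - 1) = INR N - 1) by (rewrite minus_INR by lia; simpl; ring).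
  set (n := INR N - 2) in *.
  set (Ia := fun t => RInt (moment 1) 1 (exp t)).
  set (Ib := fun t => RInt (moment (N - 1)) 1 (exp t)).
  assert (dIa : forall t, is_derive Ia t (exp (2 * t) * source (exp t))).
  { intros t. replace (exp (2 * t) * source (exp t)) with (exp t * moment 1 (exp t)).
    - apply is_derive_RInt_exp, continuous_moment.
    - unfold moment. rewrite exp_pow_INR, <- Rmult_assoc, <- exp_plus. do 2 f_equal. simpl; ring. }
  assert (dIb : forall t, is_derive Ib t (exp (n * t) * (exp (2 * t) * source (exp t)))).
  { intros t. replace (exp (n * t) * (exp (2 * t) * source (exp t)))
      with (exp t * moment (N - 1) (exp t)).
    - apply is_derive_RInt_exp, continuous_moment.
    - unfold moment. rewrite exp_pow_INR, <- !Rmult_assoc, <- !exp_plus, HN1. do 2 f_equal.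
      unfold n; ring. }
  assert (HU : forall t, zeta - (A0 + Ia t - exp (- n * t) * (B0 + Ib t)) / n = u (exp t)).
  { intros t. rewrite (Hu (exp t) (exp_pos t)), exp_pow_INR, HN2, <- exp_Ropp.
    fold (Ia t) (Ib t). do 5 f_equal. ring. }
  assert (Hee : forall t, exp (- n * t) * exp (n * t) = 1).
  { intros t. rewrite <- exp_plus, <- exp_0. f_equal; ring. }
  exists (fun t => exp (- n * t) * (B0 + Ib t)). split; [|split; [|split]].
  - intros t. apply (is_derive_ext _ _ _ _ HU).
    pose proof (dIa t) as H1. pose proof (dIb t) as H2.
    auto_derive; [repeat split; eexists; eassumption|].
    use_derive H1. use_derive H2. specialize (Hee t).
    set (E1 := exp (- n * t)) in *. set (E2 := exp (n * t)) in *.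
    set (X := exp (2 * t) * source (exp t)).
    replace (E1 * (1 * (E2 * X))) with (E1 * E2 * X) by ring. rewrite Hee. field. unfold n; lra.
  - intros t. pose proof (dIb t) as H2.
    auto_derive; [repeat split; eexists; eassumption|].
    use_derive H2. specialize (Hee t).
    set (E1 := exp (- n * t)) in *. set (E2 := exp (n * t)) in *.
    set (X := exp (2 * t) * source (exp t)).
    replace (E1 * (1 * (E2 * X))) with (E1 * E2 * X) by ring. rewrite Hee.
    assert (HX : X = K (exp t) * exp (- alpha * t) * exp ((2 + alpha) * t) * rpow (u (exp t)) p
                     + mu * exp (2 * t) * f (exp t)).
    { unfold X, source. rewrite rpow_Rmax.
      replace (exp (2 * t)) with (exp (- alpha * t) * exp ((2 + alpha) * t)) at 1
        by (rewrite <- exp_plus; f_equal; ring).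
      replace (exp (2 * t)) with (exp (- alpha * t) * exp ((2 + alpha) * t))
        by (rewrite <- exp_plus; f_equal; ring). ring. }
    rewrite <- HX. ring.
  (* The flux is [B0] minus the moment of order [N - 1] over [[exp t, 1]], and [B0] is the limit of
     that moment. *)
  - intros eps Heps. destruct (filterlim_exp _ _ eps HB Heps) as [T HT].
    exists T. intros t Ht. specialize (HT t Ht).
    rewrite <- Rmult_assoc, (Rmult_comm (exp (n * t))), Hee, Rmult_1_l.
    assert (Hsw : Ib t = - RInt (moment (N - 1)) (exp t) 1).
    { unfold Ib. rewrite <- (opp_RInt_swap (V := R_CompleteNormedModule)); [reflexivity|].
      apply ex_RInt_positive; [apply continuous_moment|apply exp_pos|lra]. }
    rewrite Hsw. rewrite Rabs_minus_sym in HT. exact HT.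
  - intros eps Heps. destruct u_reg as [_ [Hlim _]].
    exact (filterlim_exp u zeta eps Hlim Heps).
Qed.

End Reduction.

(** * Return to the radial variable *)

Theorem theorem4p1 (N : nat) (K f : R -> R) (alpha k0 nu mu p rs : R)
  (us : R -> R) (u : R -> R -> R) :
  (3 <= N)%nat ->
  0 <= mu ->
  K0 K alpha k0 ->
  F0 f nu ->
  pS N alpha < p ->
  below_pJL N alpha p ->
  0 < rs ->
  singular_solution N K f mu p rs us ->
  (forall zeta, 0 < zeta -> regular_solution N K f mu p zeta (u zeta)) ->
  forall rho, 0 < rho <= rs ->
  forall M : nat, exists Z : R, forall zeta, Z < zeta ->
    at_least_zeros (fun r => u zeta r - us r) 0 rho M.
Proof.
  intros HN Hmu [K_cont [K_pos [Halpha [Hk0 K_lim]]]] [f_cont [f_nonneg [_ [Hnu [C [d [Hd Hf]]]]]]]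
    HpS HpJL Hrs [Hode Hblow] Hreg rho Hrho M.
  pose proof HN as HNR. apply (le_INR 3) in HNR. simpl in HNR.
  set (n := INR N - 2). set (beta := 2 + alpha).
  assert (Hn : 0 < n) by (unfold n; lra).
  assert (Hbeta : 0 < beta) by (unfold beta; lra).
  assert (HpS' : n + 2 * beta < p * n).
  { unfold pS in HpS. replace (n + 2 * beta) with ((INR N + 2 + 2 * alpha) / (INR N - 2) * n)
      by (unfold n, beta; field; lra).
    apply Rmult_lt_compat_r; trivial. }
  assert (Hp : 1 < p) by (apply Rmult_lt_reg_r with n; lra).
  assert (Hsup : 2 * theta beta p < n).
  { unfold theta. apply Rmult_lt_reg_r with (p - 1); [lra|].
    replace (2 * (beta / (p - 1)) * (p - 1)) with (2 * beta) by (field; lra). lra. }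
  assert (Hosc : friction n beta p ^ 2 / 4 < (p - 1) * lin_coef n beta p).
  { apply joseph_lundgren; trivial. intros Hlt. unfold below_pJL in HpJL.
    destruct (Rlt_dec (10 + 4 * alpha) (INR N)) as [_|Hge]; [|unfold n, beta in Hlt; lra].
    replace (INR N - 4 - alpha - sqrt ((2 + alpha) * (2 * INR N - 2 + alpha)))
      with (n - beta - sqrt (beta * (2 * n + beta))) in HpJL.
    2:{ unfold n, beta. f_equal; [ring|]. do 2 f_equal; ring. }
    fold beta in HpJL. set (D := sqrt (beta * (2 * n + beta))) in *.
    assert (HD2 : D * D = beta * (2 * n + beta)) by (apply sqrt_sqrt; nra).
    assert (HD0 : 0 <= D) by apply sqrt_pos.
    (* Clearing the denominator in [p_JL] needs its sign; it follows from [(n - beta) ^ 2 - D ^ 2 =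
       n (n - 4 beta) > 0]. *)
    assert (HD : 0 < n - beta - D).
    { apply Rnot_le_lt; intros Hle.
      assert ((n - beta) * (n - beta) <= D * D) by (apply Rmult_le_compat; lra).
      assert (0 < n * (n - 4 * beta)) by (apply Rmult_lt_0_compat; lra). lra. }
    replace (2 * beta) with (2 * beta / (n - beta - D) * (n - beta - D)) by (field; lra).
    apply Rmult_lt_compat_r; lra. }
  set (k := fun t => K (exp t) * exp (- alpha * t)).
  set (phi := fun t => mu * exp (2 * t) * f (exp t)).
  assert (Hkpos : forall t, 0 < k t).
  { intros t. apply Rmult_lt_0_compat; [apply K_pos|]; apply exp_pos. }
  assert (Hklim : forall eps, 0 < eps -> exists T, forall t, t <= T -> Rabs (k t - k0) <= eps).
  { intros eps Heps. destruct (filterlim_exp _ _ eps K_lim Heps) as [T HT].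
    exists T. intros t Ht. specialize (HT t Ht).
    replace (k t) with (K (exp t) / Rpower (exp t) alpha); trivial.
    unfold Rpower, Rdiv. rewrite ln_exp, <- exp_Ropp. unfold k. do 2 f_equal. ring. }
  assert (Hphi : forall t, 0 <= phi t).
  { intros t. apply Rmult_le_pos; [|apply f_nonneg, exp_pos].
    apply Rmult_le_pos; [trivial|left; apply exp_pos]. }
  assert (HC : 0 <= mu * Rabs C) by (apply Rmult_le_pos; [trivial|apply Rabs_pos]).
  (* [C] may have any sign, hence [Rabs C]; the half in [ln (d / 2)] makes [exp t < d] strict. *)
  assert (Hphile : forall t, t <= ln (d / 2) -> phi t <= mu * Rabs C * exp ((nu + 2) * t)).
  { intros t Ht. apply exp_le_mono in Ht. rewrite exp_ln in Ht by lra.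
    assert (Hr : 0 < exp t < d) by (split; [apply exp_pos|lra]). specialize (Hf (exp t) Hr).
    unfold Rpower in Hf. rewrite ln_exp in Hf.
    assert (Hf2 : f (exp t) <= Rabs C * exp (nu * t)).
    { eapply Rle_trans; [exact Hf|]. apply Rmult_le_compat_r; [left; apply exp_pos|apply Rle_abs]. }
    replace ((nu + 2) * t) with (2 * t + nu * t) by ring. rewrite exp_plus. unfold phi.
    replace (mu * Rabs C * (exp (2 * t) * exp (nu * t)))
      with (mu * exp (2 * t) * (Rabs C * exp (nu * t))) by ring.
    apply Rmult_le_compat_l; trivial. apply Rmult_le_pos; [trivial|left; apply exp_pos]. }
  assert (Hrange : forall t, t < ln rho -> 0 < exp t < rho).
  { intros t Ht. split; [apply exp_pos|]. rewrite <- (exp_ln rho) by lra. now apply exp_increasing. }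
  (* The singular solution is used only before [ln rho], so all intersections lie in [(0, rho)]. The
     decay rate [sigma] of [phi] is [nu + 2]. *)
  destruct (many_intersections n beta p k0 (nu + 2) (mu * Rabs C) (ln (d / 2)) k phi
    Hn Hbeta Hp Hk0 ltac:(lra) HC Hsup Hkpos Hklim Hphi Hphile
    (fun t => us (exp t)) (fun t => - (exp t * Derive us (exp t))) (ln rho) M Hosc)
    as [Z [HZ Hint]].
  - intros t Ht. apply Hrange in Ht. destruct (Hode (exp t) ltac:(lra)) as (_ & _ & H & _). exact H.
  - intros t Ht. apply Hrange in Ht. destruct (Hode (exp t) ltac:(lra)) as (H & _).
    rewrite Ropp_involutive. apply (is_derive_comp us exp); [now apply Derive_correct|].
    apply is_derive_exp.
  - intros t Ht. apply Hrange in Ht. destruct (Hode (exp t) ltac:(lra)) as (_ & H & _ & Heq).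
    pose proof (is_derive_comp (Derive us) exp t _ _ (Derive_correct _ _ H) (is_derive_exp t)) as H1.
    unfold scal in H1; simpl in H1; unfold mult in H1; simpl in H1.
    set (v := fun s => Derive us (exp s)) in *.
    change (Derive us (exp t)) with (v t) in Heq.
    change (Derive_n us 2 (exp t)) with (Derive (Derive us) (exp t)) in Heq.
    set (w := Derive (Derive us) (exp t)) in *.
    change (is_derive (fun s => - (exp s * v s)) t (- n * - (exp t * v t) +
      (k t * exp (beta * t) * Rpower (us (exp t)) p + phi t))).
    auto_derive; [eexists; exact H1|]. use_derive H1.
    assert (Hkb : k t * exp (beta * t) = exp t ^ 2 * K (exp t)).
    { unfold k, beta. rewrite Rmult_assoc, <- exp_plus, exp_pow_INR.
      rewrite (Rmult_comm (exp (INR 2 * t))). do 2 f_equal. simpl; ring. }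
    assert (Hphit : phi t = exp t ^ 2 * (mu * f (exp t))).
    { unfold phi. rewrite exp_pow_INR. replace (INR 2) with 2 by (simpl; ring). ring. }
    rewrite Hkb, Hphit.
    assert (Hw : w = - ((INR N - 1) / exp t * v t + K (exp t) * Rpower (us (exp t)) p
                        + mu * f (exp t))) by lra.
    rewrite Hw. unfold n. field. lra.
  - intros X. destruct (at_right_exp (fun r => X <= us r)) as [T HT]; [|now exists T].
    apply (Hblow (fun y => X <= y)). exists X. intros y Hy; lra.
  - exists Z. intros zeta Hzeta.
    destruct (regular_solution_flow N K f mu p zeta (u zeta) HN ltac:(lra) K_cont f_cont
                (Hreg zeta ltac:(lra)) alpha) as [P HP].
    destruct (Hint zeta _ P Hzeta HP) as [tt [Htt Hmono]].
    exists (fun i => exp (tt i)). split.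
    + intros i Hi. destruct (Htt i Hi) as [Hlt Heq]. split; [now apply Hrange|lra].
    + intros i Hi. now apply exp_increasing, Hmono.
Qed.
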